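(* The problem of deciding, given a simple graph $G$, whether $\eta(G)=0$ is NP-complete, even when restricted to connected simple graphs $G$ of odd order with a unique universal vertex.
   Context: For a simple graph $G$ of order $N$ with adjacency matrix $A$ and vertex set $V$, a labeling is a bijection $\pi:\mathbb{Z}_N\to V$, and $A_\pi$ is the matrix indexed by $\mathbb{Z}_N$ with $A_\pi(x,y)=A_{\pi(x)\pi(y)}$. Let $F_N(r,x)=\frac{1}{\sqrt N}e^{-2\pi i rx/N}$ for $r,x\in\mathbb{Z}_N$, let $\|\cdot\|_2$ be the Frobenius norm and let $\operatorname{Im}$ be taken entrywise. Define $\eta(G)=\min_\pi\|\operatorname{Im}(F_NA_\pi F_N)\|_2^2$, the minimum over all labelings; thus $\eta(G)=0$ means that some labeling makes every entry of $F_NA_\pi F_N$ real. A universal vertex is a vertex adjacent to all other vertices. NP-completeness is with respect to polynomial-time reductions. The following known result of Lubiw may be assumed: given a simple graph $H$, deciding whether $H$ has a fixed-point-free involutory automorphism (an automorphism $\tau$ with $\tau^2=\mathrm{id}$ and $\tau(v)\ne v$ for every vertex $v$) is NP-complete. *)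

(* Defs.v *)
From mathcomp Require Import all_boot all_order all_algebra all_fingroup.
From mathcomp Require Import complex.
From mathcomp Require Import reals trigo.

Set Implicit Arguments.
Unset Strict Implicit.
Unset Printing Implicit Defensive.

Import Order.TTheory GRing.Theory Num.Theory.
Local Open Scope ring_scope.

(** * Deterministic multi-tape Turing machines *)

(* A symbol is a bit [Some b] or the blank [None]. The tape is infinite in both
   directions: [(l, r)] has [l] to the left of the head (nearest cell first) and
   [r] from the scanned cell rightwards; all cells beyond [l] and [r] are blank. *)
Definition symbol := option bool.
Definition tape := (seq symbol * seq symbol)%type.

Inductive move := MoveLeft | MoveRight | Stay.

Definition read (t : tape) : symbol := head None t.2.

Definition write (a : symbol) (t : tape) : tape := (t.1, a :: behead t.2).

Definition shift (m : move) (t : tape) : tape :=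
  match m with
  | MoveLeft => (behead t.1, head None t.1 :: t.2)
  | MoveRight => (head None t.2 :: t.1, behead t.2)
  | Stay => t
  end.

(* At least two tapes, so that a verifier can receive the instance on tape 0
   and the certificate on tape 1. *)
Record machine := Machine {
  extra_tapes : nat;
  state : finType;
  start : state;
  halting : pred state;
  trans : state -> {ffun 'I_extra_tapes.+2 -> symbol} ->
          state * ('I_extra_tapes.+2 -> symbol * move)
}.

Definition config (M : machine) : Type :=
  (state M * {ffun 'I_(extra_tapes M).+2 -> tape})%type.

Definition step (M : machine) (c : config M) : config M :=
  if halting c.1 then c else
  let: (q, act) := trans c.1 [ffun i => read (c.2 i)] in
  (q, [ffun i => shift (act i).2 (write (act i).1 (c.2 i))]).

Definition init (M : machine) (x y : seq bool) : config M :=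
  (start M, [ffun i : 'I_(extra_tapes M).+2 =>
               ([::], map Some (nth [::] [:: x; y] i))]).

(* The word read on tape 0 from the head rightwards, up to the first blank. *)
Definition output (M : machine) (c : config M) : seq bool :=
  let s := (c.2 ord0).2 in pmap id (take (index None s) s).

Definition computes_within (M : machine) (x y z : seq bool) (t : nat) : Prop :=
  let c := iter t (@step M) (init M x y) in halting c.1 /\ output c = z.

(** * Polynomial time and NP-completeness *)

Definition polytime (f : seq bool -> seq bool) : Prop :=
  exists (M : machine) (p : {poly nat}),
    forall x, computes_within M x [::] (f x) p.[size x].

Definition polytime_verifier (V : seq bool -> seq bool -> bool) : Prop :=
  exists (M : machine) (p : {poly nat}),
    forall x c, computes_within M x c [:: V x c] p.[(size x + size c)%N].

Definition language := seq bool -> Prop.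

Definition NP (L : language) : Prop :=
  exists (V : seq bool -> seq bool -> bool) (p : {poly nat}),
    polytime_verifier V /\
    forall x, L x <-> exists c, (size c <= p.[size x])%N /\ V x c.

Definition reduction (L L' : language) (f : seq bool -> seq bool) : Prop :=
  polytime f /\ forall x, L x <-> L' (f x).

Definition NP_complete (L : language) : Prop :=
  NP L /\ forall L', NP L' -> exists f, reduction L' L f.

(* NP-completeness of [L] restricted to the instances in [D]: reductions must
   send every word, hence also every negative instance, to an instance in [D]. *)
Definition NP_complete_on (D L : language) : Prop :=
  NP (fun x => D x /\ L x) /\
  forall L', NP L' -> exists f, reduction L' L f /\ forall x, D (f x).

(** * Graphs *)

Record sgraph := SGraph {
  gorder : nat;
  adj : rel 'I_gorder;
  gorder_gt0 : (0 < gorder)%N;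
  adj_sym : symmetric adj;
  adj_irr : irreflexive adj
}.

(* The order in unary, a separator, then the adjacency matrix row by row. *)
Definition encode (G : sgraph) : seq bool :=
  nseq (gorder G) true ++
  false :: [seq adj i j | i <- enum 'I_(gorder G), j <- enum 'I_(gorder G)].

Definition graph_language (P : sgraph -> Prop) : language :=
  fun w => exists G, w = encode G /\ P G.

Definition connected_graph (G : sgraph) : Prop :=
  forall u v : 'I_(gorder G), connect (@adj G) u v.

Definition universal (G : sgraph) (v : 'I_(gorder G)) : Prop :=
  forall u, u != v -> adj v u.

Definition unique_universal (G : sgraph) : Prop :=
  exists! v : 'I_(gorder G), universal v.

Definition has_fpf_involution (G : sgraph) : Prop :=
  exists t : {perm 'I_(gorder G)},
    [/\ forall u v, adj (t u) (t v) = adj u v,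
        forall v, t (t v) = v
      & forall v, t v != v].

(** * The invariant eta *)

Section Eta.
Variable R : realType.

(* Z_N is represented by the residues 0, ..., N - 1 in ['I_N]. *)
Definition fourier (N : nat) : 'M[R[i]]_N :=
  \matrix_(r, x)
    let theta : R := 2 * pi * (r%:R * x%:R) / N%:R in
    Complex ((Num.sqrt N%:R)^-1 * cos (- theta))
            ((Num.sqrt N%:R)^-1 * sin (- theta)).

(* Vertices are also numbered 0, ..., N - 1, so that the labelings Z_N -> V are
   the permutations of ['I_N]. *)
Definition labeled_adjacency (G : sgraph) (p : {perm 'I_(gorder G)}) :
    'M[R[i]]_(gorder G) :=
  \matrix_(x, y) (adj (p x) (p y))%:R.

Definition frobenius (m n : nat) (M : 'M[R]_(m, n)) : R :=
  Num.sqrt (\sum_i \sum_j `|M i j| ^+ 2).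

Definition eta_at (G : sgraph) (p : {perm 'I_(gorder G)}) : R :=
  let F := fourier (gorder G) in
  frobenius (map_mx (@complex.Im R) (F *m labeled_adjacency p *m F)) ^+ 2.

Definition eta (G : sgraph) : R :=
  \big[Num.min/eta_at (1%g : {perm 'I_(gorder G)})]_(p : {perm 'I_(gorder G)})
    eta_at p.

End Eta.

(* Main.v *)
Require Import Defs.
From mathcomp Require Import all_boot all_algebra.
From mathcomp Require Import reals.
From mathcomp Require Import all_order all_fingroup complex trigo zify ring.
From mathcomp Require boolp.

(** Let [P] be the permutation matrix of negation on Z_N. The conjugate of [F] is
    [F P = P F], so for a real matrix [B] the product [F B F] is real iff
    [F B F = F (P B P) F], iff [B = P B P], because [F F = P] makes [F] invertible.
    Hence eta(G) = 0 iff [G] has an involutive automorphism conjugate to negation,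
    i.e. with one or two fixed points (the parity of [N] decides which). Such an
    automorphism is a certificate that is checked in polynomial time.

    For hardness, add to a graph [H] of even order two isolated vertices and then a
    universal vertex. The universal vertex is now unique, hence fixed by every
    automorphism; since the new order is odd, it is the only fixed point, and the
    involution can be rerouted around the two isolated vertices to give a
    fixed-point-free involution of [H]. Graphs of odd order have none.

    Running times are controlled by writing all algorithms in a language of string
    expressions whose only iteration is concatenation over the suffixes of a string;
    every expression of that language compiles to a polynomial-time machine. *)

Set Implicit Arguments.
Unset Strict Implicit.
Unset Printing Implicit Defensive.

Local Open Scope nat_scope.

(** * Turing machines acting on tapes used as stacks *)

(** The number two of isolated vertices answers two demands. With none, a universal vertex of [H]
    would compete with the added one. With one, the new order would be even and negation on Z_N
    would fix both 0 and N/2, so an admissible involution could fix a vertex of [H] as well. With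
    two, the order is odd and the only ambiguity left is that they may be exchanged with isolated
    vertices of [H], which rerouting repairs.

    The restricted form of completeness asks that every word be sent to an admissible graph. Words
    that encode no graph of even order are therefore replaced by a fixed negative instance, the star
    K_{1,3}.

    The reduction supplied by the assumed hardness is an arbitrary multi-tape machine. Compilation
    must therefore also allow an expression to be run after a foreign machine, on tapes whose
    contents are known only in part. *)

Section Fragments.
Variable k : nat.

Definition symbols := {ffun 'I_k.+2 -> symbol}.
Definition actions := 'I_k.+2 -> symbol * move.
Definition tapes := {ffun 'I_k.+2 -> tape}.

(** The tape count is a parameter here rather than a field, so that programs acting on the same
    tapes can be composed. *)
Record frag := Frag {
  fstate : finType;
  fstart : fstate;
  fhalt : pred fstate;
  ftrans : fstate -> symbols -> fstate * actions
}.

Definition machine_of (M : frag) : machine :=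
  @Machine k (fstate M) (fstart M) (@fhalt M) (@ftrans M).

Definition fstep (M : frag) (c : fstate M * tapes) : fstate M * tapes :=
  @step (machine_of M) c.

Definition reaches (M : frag) (c c' : fstate M * tapes) (n : nat) : Prop :=
  exists2 m, m <= n & iter m (@fstep M) c = c'.

Definition runs (M : frag) (t t' : tapes) (n : nat) : Prop :=
  exists2 q, fhalt q & reaches (fstart M, t) (q, t') n.

Definition perform (a : actions) (t : tapes) : tapes :=
  [ffun i => shift (a i).2 (write (a i).1 (t i))].

Definition scan (t : tapes) : symbols := [ffun i => read (t i)].

Lemma fstepE (M : frag) q t :
  @fstep M (q, t) = if fhalt q then (q, t) else
    ((ftrans q (scan t)).1, perform (ftrans q (scan t)).2 t).
Proof. by rewrite /fstep /step /=; case: ifP => // _; case: (ftrans _ _). Qed.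

Lemma fstep_halt (M : frag) n q t :
  fhalt q -> iter n (@fstep M) (q, t) = (q, t).
Proof. by move=> hq; elim: n => //= n ->; rewrite fstepE hq. Qed.

Lemma reaches_trans M c2 c1 c3 n1 n2 :
  @reaches M c1 c2 n1 -> @reaches M c2 c3 n2 -> @reaches M c1 c3 (n1 + n2).
Proof.
move=> [m1 h1 <-] [m2 h2 <-]; exists (m2 + m1); last by rewrite iterD.
by rewrite addnC leq_add.
Qed.

Lemma reaches_step M q t :
  ~~ fhalt q ->
  @reaches M (q, t) ((ftrans q (scan t)).1, perform (ftrans q (scan t)).2 t) 1.
Proof. by move=> hq; exists 1 => //=; rewrite fstepE (negPf hq). Qed.

Lemma reaches_le M c c' n m : n <= m -> @reaches M c c' n -> @reaches M c c' m.
Proof. by move=> le [x xn <-]; exists x => //; apply: leq_trans le. Qed.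

Lemma runs_le M t t' n m : n <= m -> @runs M t t' n -> @runs M t t' m.
Proof. by move=> le [q hq h]; exists q => //; apply: reaches_le h. Qed.

(** Only non-halting states need to be simulated: in a composite program a halting state of a
    component is where control passes on. *)
Lemma reaches_embed (M M' : frag) (i : fstate M -> fstate M') q t q' t' n :
  (forall p, ~~ fhalt p -> ~~ fhalt (i p) /\
     forall r, ftrans (i p) r = (i (ftrans p r).1, (ftrans p r).2)) ->
  @reaches M (q, t) (q', t') n -> @reaches M' (i q, t) (i q', t') n.
Proof.
move=> hi [m le_mn]; elim: m q t n le_mn => [|m IH] q t n le_mn.
  by case=> <- <-; exists 0.
case: (boolP (fhalt q)) => [hq|nhq].
  by rewrite (fstep_halt _ _ hq) => -[<- <-]; exists 0.
case: n le_mn => // n le_mn; rewrite iterSr fstepE (negPf nhq) => /(IH _ _ n le_mn).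
have [nh tr] := hi q nhq.
have /= := reaches_step t nh; rewrite tr /= => st.
by rewrite -add1n; apply: reaches_trans.
Qed.

(** Writing back the scanned symbol may turn an empty right half into an explicit blank. Hence
    [perform (idle (scan t)) t] appears at every transfer of control; it preserves the words on the
    tapes but not the lists. *)
Definition idle (r : symbols) : actions := fun i => (r i, Stay).

Definition act_frag (f : symbols -> actions) : frag :=
  @Frag bool false id (fun _ r => (true, f r)).

Definition seq_frag (M1 M2 : frag) : frag :=
  @Frag (fstate M1 + fstate M2)%type (inl (fstart M1))
    (fun q => if q is inr q then fhalt q else false)
    (fun q r => match q with
     | inl q => if fhalt q then (inr (fstart M2), idle r)
                else (inl (ftrans q r).1, (ftrans q r).2)
     | inr q => (inr (ftrans q r).1, (ftrans q r).2)
     end).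

Definition ite_frag (P : pred symbols) (M1 M2 : frag) : frag :=
  @Frag (option (fstate M1 + fstate M2)) None
    (fun q => match q with
     | Some (inl q) => fhalt q | Some (inr q) => fhalt q | None => false end)
    (fun q r => match q with
     | Some (inl q) => (Some (inl (ftrans q r).1), (ftrans q r).2)
     | Some (inr q) => (Some (inr (ftrans q r).1), (ftrans q r).2)
     | None => (Some (if P r then inl (fstart M1) else inr (fstart M2)), idle r)
     end).

(** [inr false] tests the guard, [inr true] is the exit. *)
Definition while_frag (P : pred symbols) (M : frag) : frag :=
  @Frag (fstate M + bool)%type (inr false)
    (fun q => if q is inr b then b else false)
    (fun q r => match q with
     | inl q => if fhalt q then (inr false, idle r)
                else (inl (ftrans q r).1, (ftrans q r).2)
     | inr _ => (if P r then inl (fstart M) else inr true, idle r)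
     end).

Lemma runs_act f t : runs (act_frag f) t (perform (f (scan t)) t) 1.
Proof. by exists true => //; exact: (@reaches_step (act_frag f) false). Qed.

Lemma runs_seq M1 M2 t t1 t2 n1 n2 :
  runs M1 t t1 n1 -> runs M2 (perform (idle (scan t1)) t1) t2 n2 ->
  runs (seq_frag M1 M2) t t2 (n1 + 1 + n2).
Proof.
move=> [q1 h1 r1] [q2 h2 r2]; exists (inr q2) => //.
apply: reaches_trans; last first.
  by apply: (@reaches_embed _ (seq_frag M1 M2) inr) r2.
apply: reaches_trans.
  by apply: (@reaches_embed _ (seq_frag M1 M2) inl) r1 => p /negPf /= ->.
by have := @reaches_step (seq_frag M1 M2) (inl q1) t1 isT; rewrite /= h1.
Qed.

Lemma runs_ite (P : pred symbols) M1 M2 t t' n :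
  runs (if P (scan t) then M1 else M2) (perform (idle (scan t)) t) t' n ->
  runs (ite_frag P M1 M2) t t' (1 + n).
Proof.
have := @reaches_step (ite_frag P M1 M2) None t isT => /=.
case: ifP => _ st [q hq r]; [exists (Some (inl q)) | exists (Some (inr q))] => //;
  apply: (reaches_trans st).
- exact: (@reaches_embed _ (ite_frag P M1 M2) (fun q => Some (inl q))) r.
- exact: (@reaches_embed _ (ite_frag P M1 M2) (fun q => Some (inr q))) r.
Qed.

Lemma runs_while_exit (P : pred symbols) M t :
  ~~ P (scan t) -> runs (while_frag P M) t (perform (idle (scan t)) t) 1.
Proof.
move=> /negPf hP; exists (inr true) => //.
by have := @reaches_step (while_frag P M) (inr false) t isT; rewrite /= hP.
Qed.

Lemma runs_while_enter (P : pred symbols) M t t1 t2 n1 n2 :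
  P (scan t) -> runs M (perform (idle (scan t)) t) t1 n1 ->
  runs (while_frag P M) (perform (idle (scan t1)) t1) t2 n2 ->
  runs (while_frag P M) t t2 (1 + n1 + 1 + n2).
Proof.
move=> hP [q1 h1 r1] [q2 h2 r2]; exists q2 => //.
apply: reaches_trans r2; apply: reaches_trans; last first.
  by have st := @reaches_step (while_frag P M) (inl q1) t1 isT; rewrite /= h1 in st; apply: st.
apply: reaches_trans.
  by have st := @reaches_step (while_frag P M) (inr false) t isT; rewrite /= hP in st;
      apply: st.
by apply: (@reaches_embed _ (while_frag P M) inl) r1 => p /negPf /= ->.
Qed.

End Fragments.

(* A tape is used as a stack: its value is the word from the head up to the
   first blank, whatever lies elsewhere on the tape. *)
Fixpoint word_at (r : seq symbol) : seq bool :=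
  if r is Some b :: r' then b :: word_at r' else [::].

Lemma word_at_output r : pmap id (take (index None r) r) = word_at r.
Proof. by elim: r => // -[b|] r //= ->. Qed.

Lemma word_at_map s : word_at (map Some s) = s.
Proof. by elim: s => //= b s ->. Qed.

Lemma size_word_at r : size (word_at r) <= size r.
Proof. by elim: r => // -[b|] r. Qed.

(** * Programs on registers *)

Definition store := nat -> seq bool.
Definition upd (s : store) (r : nat) (v : seq bool) : store :=
  fun i => if i == r then v else s i.

Section Computes.
Variable k : nat.
Implicit Types (s : store) (M : frag k) (t : tapes k).

Definition holds t s : Prop :=
  forall i, i < k.+2 -> word_at (t (inord i)).2 = s i.

Definition computes M s s' n : Prop :=
  forall t, holds t s -> exists2 t', holds t' s' & runs M t t' n.

Lemma computes_le M s s1 n m : n <= m -> computes M s s1 n -> computes M s s1 m.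
Proof. by move=> le h t /h[t' ht r]; exists t' => //; apply: runs_le r. Qed.

Lemma word_at_idle t i : word_at (perform (idle (scan t)) t i).2 = word_at (t i).2.
Proof. by rewrite /perform /idle !ffunE /=; case: (t _) => l [|[b|] r]. Qed.

Lemma holds_idle t s : holds t s -> holds (perform (idle (scan t)) t) s.
Proof. by move=> h i ik; rewrite word_at_idle h. Qed.

Lemma scan_ohead t s r : r < k.+2 -> holds t s -> scan t (inord r) = ohead (s r).
Proof.
by move=> rk /(_ r rk) <-; rewrite ffunE /read; case: (t _) => l [|[b|] w].
Qed.

Definition on_tape r (a : symbol -> symbol * move) (x : symbols k) : actions k :=
  fun i => if i == inord r then a (x i) else idle x i.

Lemma word_at_on_tape t r a i :
  r < k.+2 -> i < k.+2 ->
  word_at (perform (on_tape r a (scan t)) t (inord i)).2 =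
  if i == r then word_at (shift (a (read (t (inord r)))).2
                          (write (a (read (t (inord r)))).1 (t (inord r)))).2
  else word_at (t (inord i)).2.
Proof.
move=> rk ik; rewrite ffunE /on_tape; case: (i =P r) => [->|ne].
  by rewrite eqxx !ffunE.
rewrite ifN; last by apply/eqP => /(congr1 val); rewrite /= !inordK.
by rewrite -[RHS]word_at_idle !ffunE.
Qed.

Lemma holds_on_tape t s r a v :
  r < k.+2 -> holds t s ->
  word_at (shift (a (read (t (inord r)))).2
             (write (a (read (t (inord r)))).1 (t (inord r)))).2 = v ->
  holds (perform (on_tape r a (scan t)) t) (upd s r v).
Proof.
move=> rk h e i ik; rewrite /upd word_at_on_tape //.
by case: ifP => // _; exact: h.
Qed.

(** A blank under the head suffices: the rest of the old word stays behind it, outside the stack. *)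
Definition clear_reg r : frag k :=
  act_frag (on_tape r (fun=> (None, Stay))).

Lemma computes_clear r s : r < k.+2 -> computes (clear_reg r) s (upd s r [::]) 1.
Proof.
move=> rk t h; eexists; last exact: runs_act.
by apply: holds_on_tape h _.
Qed.

(** On a blank the head must not move, since debris of earlier words may follow. *)
Definition pop_reg r : frag k :=
  act_frag (on_tape r (fun a => (a, if a is None then Stay else MoveRight))).

Lemma computes_pop r s :
  r < k.+2 -> computes (pop_reg r) s (upd s r (behead (s r))) 1.
Proof.
move=> rk t h; eexists; last exact: runs_act.
apply: (holds_on_tape rk h); move: (h r rk).
by case: (t _) => l [|[b|] w] <-.
Qed.

Lemma computes_seq M1 M2 s s1 s2 n1 n2 :
  computes M1 s s1 n1 -> computes M2 s1 s2 n2 ->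
  computes (seq_frag M1 M2) s s2 (n1 + 1 + n2).
Proof.
move=> c1 c2 t /c1[t1 /holds_idle/c2[t2 h2 r2] r1].
by exists t2 => //; apply: runs_seq r1 r2.
Qed.

(* The head first moves onto the cell on the left and then overwrites it. *)
Definition push_reg r b : frag k :=
  seq_frag (act_frag (on_tape r (fun a => (a, MoveLeft))))
           (act_frag (on_tape r (fun=> (Some b, Stay)))).

Lemma computes_push r b s :
  r < k.+2 -> computes (push_reg r b) s (upd s r (b :: s r)) 3.
Proof.
move=> rk t h; eexists; last first.
  by apply: (@runs_le _ _ _ _ (1 + 1 + 1)) => //; apply: runs_seq; exact: runs_act.
move=> i ik; rewrite /upd word_at_on_tape //; case: ifP => [_|ne].
  rewrite /= -(h r rk).
  by rewrite !ffunE /on_tape eqxx !ffunE; case: (t _) => -[|? ?] [|[c|] w].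
by rewrite word_at_idle word_at_on_tape // ne h.
Qed.

Definition nonempty_reg r : pred (symbols k) := fun x => isSome (x (inord r)).
Definition true_reg r : pred (symbols k) := fun x => x (inord r) == Some true.

Lemma computes_if_nonempty r M1 M2 s s' n :
  r < k.+2 -> computes (if s r != [::] then M1 else M2) s s' n ->
  computes (ite_frag (nonempty_reg r) M1 M2) s s' (1 + n).
Proof.
move=> rk c t h; have [t' h' r'] := c _ (holds_idle h); exists t' => //.
apply: runs_ite; move: r'; rewrite /nonempty_reg (scan_ohead rk h).
by case: (s r).
Qed.

Lemma computes_if_true r M1 M2 s s' n :
  r < k.+2 -> computes (if head false (s r) then M1 else M2) s s' n ->
  computes (ite_frag (true_reg r) M1 M2) s s' (1 + n).
Proof.
move=> rk c t h; have [t' h' r'] := c _ (holds_idle h); exists t' => //.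
apply: runs_ite; move: r'; rewrite /true_reg (scan_ohead rk h).
by case: (s r) => // -[].
Qed.

Definition while_reg r M := while_frag (nonempty_reg r) M.

Lemma computes_while_exit r M s :
  r < k.+2 -> s r = [::] -> computes (while_reg r M) s s 1.
Proof.
move=> rk e t h; eexists; first exact: holds_idle h.
by apply: runs_while_exit; rewrite /nonempty_reg (scan_ohead rk h) e.
Qed.

Lemma computes_while_enter r M s s1 s2 n1 n2 :
  r < k.+2 -> s r != [::] -> computes M s s1 n1 ->
  computes (while_reg r M) s1 s2 n2 ->
  computes (while_reg r M) s s2 (1 + n1 + 1 + n2).
Proof.
move=> rk ne c1 c2 t h.
have [t1 /holds_idle/c2[t2 h2 r2] r1] := c1 _ (holds_idle h).
exists t2 => //; apply: runs_while_enter r1 r2.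
by rewrite /nonempty_reg (scan_ohead rk h); case: (s r) ne.
Qed.

End Computes.
Arguments computes_clear [k r] s _.
Arguments computes_pop [k r] s _.
Arguments computes_push [k r] b s _.

(** * Polynomial-time string expressions *)

Definition poly_bounded (f : nat -> nat) : Prop :=
  exists p : {poly nat}, forall n, f n <= p.[n]%R.

Lemma horner_nat_mono (p : {poly nat}) m n : m <= n -> p.[m]%R <= p.[n]%R.
Proof.
move=> le; elim/poly_ind: p => [|p c IH]; first by rewrite !horner0.
rewrite !hornerMXaddC; change (p.[m]%R * m + c <= p.[n]%R * n + c).
by rewrite leq_add2r leq_mul.
Qed.

Lemma poly_bounded_const c : poly_bounded (fun=> c).
Proof. by exists c%:P%R => n; rewrite hornerC. Qed.

Lemma poly_bounded_id : poly_bounded id.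
Proof. by exists 'X%R => n; rewrite hornerX. Qed.

Lemma poly_boundedD f g :
  poly_bounded f -> poly_bounded g -> poly_bounded (fun n => f n + g n).
Proof.
by move=> [p hp] [q hq]; exists (p + q)%R => n; rewrite hornerD leq_add.
Qed.

Lemma poly_boundedM f g :
  poly_bounded f -> poly_bounded g -> poly_bounded (fun n => f n * g n).
Proof.
by move=> [p hp] [q hq]; exists (p * q)%R => n; rewrite hornerM leq_mul.
Qed.

Lemma poly_bounded_comp f g :
  poly_bounded f -> poly_bounded g -> poly_bounded (fun n => f (g n)).
Proof.
move=> [p hp] [q hq]; exists (p \Po q)%R => n; rewrite horner_comp.
by apply: leq_trans (hp _) _; apply: horner_nat_mono.
Qed.

(* Variables are de Bruijn levels: binders append to the environment. [Loop e1 e2]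
   concatenates the values of [e2] over the proper suffixes of [e1], shortest
   first; suffixes of length [i] stand for the integer [i]. No construct feeds the
   result of a round into the next one, so all running times are polynomial. *)
Inductive expr :=
  | Var of nat
  | Empty
  | Push of bool & expr
  | Tail of expr
  | If of expr & expr & expr & expr
  | Let of expr & expr
  | App of expr & expr
  | Drop of expr & expr
  | Loop of expr & expr.

Definition suffix_of (l : seq bool) (i : nat) : seq bool := drop (size l - i) l.

Lemma size_suffix_of l i : i <= size l -> size (suffix_of l i) = i.
Proof. by move=> h; rewrite size_drop subKn. Qed.

Fixpoint eval (e : expr) (env : seq (seq bool)) : seq bool :=
  match e with
  | Var i => nth [::] env i
  | Empty => [::]
  | Push b e => b :: eval e env
  | Tail e => behead (eval e env)
  | If e0 en et ef =>
      match eval e0 env with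
      | [::] => eval en env
      | true :: _ => eval et env
      | false :: _ => eval ef env
      end
  | Let e1 e2 => eval e2 (rcons env (eval e1 env))
  | App e1 e2 => eval e1 env ++ eval e2 env
  | Drop e1 e2 => drop (size (eval e1 env)) (eval e2 env)
  | Loop e1 e2 =>
      let l := eval e1 env in
      flatten [seq eval e2 (rcons env (suffix_of l i)) | i <- iota 0 (size l)]
  end.

(** [n] bounds every variable in scope, and a binder raises it by the bound of the new value. Sums
    stand in for maxima to stay within compositions of polynomials. *)
Fixpoint size_bound (e : expr) (n : nat) : nat :=
  match e with
  | Var _ => n
  | Empty => 0
  | Push _ e => (size_bound e n).+1
  | Tail e => size_bound e n
  | If _ en et ef => size_bound en n + size_bound et n + size_bound ef n
  | Let e1 e2 => size_bound e2 (n + size_bound e1 n)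
  | App e1 e2 => size_bound e1 n + size_bound e2 n
  | Drop _ e2 => size_bound e2 n
  | Loop e1 e2 => size_bound e1 n * size_bound e2 (n + size_bound e1 n)
  end.

(** The constants leave slack over the costs 20 L + 20 of copying and 16 L + 5 of prepending a word
    of length L. *)
Fixpoint time_bound (e : expr) (n : nat) : nat :=
  match e with
  | Var _ => 40 * n + 40
  | Empty => 1
  | Push _ e => time_bound e n + 4
  | Tail e => time_bound e n + 2
  | If e0 en et ef =>
      time_bound e0 n + time_bound en n + time_bound et n + time_bound ef n + 10
  | Let e1 e2 =>
      let m := n + size_bound e1 n in
      time_bound e1 n + time_bound e2 m + 20 * size_bound e2 m + 20
  | App e1 e2 => time_bound e1 n + time_bound e2 n + 20 * size_bound e1 n + 20
  | Drop e1 e2 => time_bound e1 n + time_bound e2 n + 20 * size_bound e1 n + 20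
  | Loop e1 e2 =>
      let m := n + size_bound e1 n in
      time_bound e1 n
      + size_bound e1 n * (time_bound e2 m + 20 * size_bound e2 m + 20) + 20
  end.

Ltac poly_bound := rewrite /=; repeat first
  [ assumption | apply: poly_bounded_const | apply: poly_bounded_id
  | apply: poly_boundedD | apply: poly_boundedM
  | match goal with H : poly_bounded (?f ?e) |- poly_bounded (fun n => ?f ?e (@?g n)) =>
      apply: (@poly_bounded_comp (f e) g H) end ].

Lemma poly_bounded_size e : poly_bounded (size_bound e).
Proof.
elim: e => [i||b e IH|e IH|e0 h0 en hn et ht ef hf|e1 h1 e2 h2|e1 h1 e2 h2|e1 h1 e2 h2
    |e1 h1 e2 h2];
  try by poly_bound.
by have [p hp] := IH; exists (p + 1)%R => n; rewrite hornerD hornerC /= -addn1 leq_add.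
Qed.

Lemma poly_bounded_time e : poly_bounded (time_bound e).
Proof.
elim: e => [i||b e IH|e IH|e0 h0 en hn et ht ef hf|e1 h1 e2 h2|e1 h1 e2 h2|e1 h1 e2 h2
    |e1 h1 e2 h2];
  try have s1 := poly_bounded_size e1; try have s2 := poly_bounded_size e2;
  by poly_bound.
Qed.

Lemma all_sizeP n (env : seq (seq bool)) i :
  all (fun v => size v <= n) env -> size (nth [::] env i) <= n.
Proof.
move=> /all_nthP h; have [lt|ge] := ltnP i (size env); first exact: h.
by rewrite nth_default.
Qed.

Lemma all_size_rcons n m (env : seq (seq bool)) v :
  all (fun v => size v <= n) env -> size v <= m ->
  all (fun v => size v <= n + m) (rcons env v).
Proof.
move=> h hv; rewrite all_rcons (leq_trans hv) ?leq_addl //=.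
by apply: sub_all h => w hw; rewrite (leq_trans hw) ?leq_addr.
Qed.

Lemma size_suffix_of_le l i : size (suffix_of l i) <= size l.
Proof. by rewrite size_drop leq_subr. Qed.

Lemma size_flatten_le (T : Type) (c : nat) (s : seq T) (f : T -> seq bool) :
  (forall x, size (f x) <= c) -> size (flatten (map f s)) <= size s * c.
Proof.
by move=> h; elim: s => //= x s IH; rewrite size_cat mulSn leq_add.
Qed.

Lemma size_eval e env n :
  all (fun v => size v <= n) env -> size (eval e env) <= size_bound e n.
Proof.
elim: e env n => [i||b e IH|e IH|e0 h0 en hn et ht ef hf|e1 h1 e2 h2|e1 h1 e2 h2
    |e1 h1 e2 h2|e1 h1 e2 h2] env n h //=.
- exact: all_sizeP.
- exact: IH.
- by rewrite size_behead (leq_trans (leq_pred _)) ?IH.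
- have := hn _ _ h; have := ht _ _ h; have := hf _ _ h.
  by case: (eval e0 env) => [|[] ?]; lia.
- by apply: h2; apply: all_size_rcons => //; apply: h1.
- by rewrite size_cat leq_add ?h1 ?h2.
- by rewrite size_drop (leq_trans (leq_subr _ _)) ?h2.
- have l1 := h1 _ _ h.
  apply: leq_trans (_ : _ <= size (eval e1 env) * size_bound e2 (n + size_bound e1 n)) _.
    rewrite -{2}(size_iota 0 (size (eval e1 env))); apply: size_flatten_le => i.
    by apply: h2; apply: all_size_rcons => //; apply: leq_trans l1; apply: size_suffix_of_le.
  by rewrite leq_mul2r l1 orbT.
Qed.

(** * Compilation of expressions to register programs *)

Section Compile.
Variable k : nat.
Implicit Types s : store.

(** The invariant is indexed by what is left in the loop register, so its length counts the rounds.
    Each round costs two more steps, to enter and to leave the body. *)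
Lemma computes_for r (M : frag k) c (I : seq bool -> store -> Prop) :
  r < k.+2 -> (forall l s, I l s -> s r = l) ->
  (forall b l s, I (b :: l) s -> exists2 s', computes M s s' c & I l s') ->
  forall l s, I l s ->
  exists2 s', computes (while_reg r M) s s' (size l * (c + 2) + 1) & I [::] s'.
Proof.
move=> rk hr hM; elim=> [|b l IH] s Is.
  by exists s => //; apply: computes_while_exit => //; exact: hr Is.
have [s1 c1 I1] := hM _ _ _ Is; have [s2 c2 I2] := IH _ I1.
exists s2 => //; apply: computes_le (computes_while_enter rk _ c1 c2).
  by rewrite /=; lia.
by rewrite (hr _ _ Is).
Qed.

Definition move_reg a b : frag k :=
  while_reg a (ite_frag (@true_reg k a) (seq_frag (pop_reg k a) (push_reg k b true))
                                        (seq_frag (pop_reg k a) (push_reg k b false))).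

Lemma updE s r v i : upd s r v i = if i == r then v else s i.
Proof. by []. Qed.

Lemma computes_move a b s :
  a < k.+2 -> b < k.+2 -> a != b ->
  exists2 s', computes (move_reg a b) s s' (8 * size (s a) + 1) &
    [/\ s' b = catrev (s a) (s b), s' a = [::] &
        forall i, i != a -> i != b -> s' i = s i].
Proof.
move=> ak bk ab; have ba : b != a by rewrite eq_sym.
pose I l (s' : store) := s' a = l /\ catrev l (s' b) = catrev (s a) (s b) /\
  forall i, i != a -> i != b -> s' i = s i.
have [|||s' c [h1 [h2 h3]]] := @computes_for a
    (ite_frag (@true_reg k a) (seq_frag (pop_reg k a) (push_reg k b true))
                (seq_frag (pop_reg k a) (push_reg k b false))) 6 I ak _ _ (s a) s.
- by move=> l s' [].
- move=> c l s1 [h1 [h2 h3]].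
  exists (upd (upd s1 a l) b (c :: s1 b)).
    apply: (computes_if_true (n := 1 + 1 + 3)) => //.
    have cp := computes_pop s1 ak; rewrite h1 /= in cp.
    rewrite h1; have /= := computes_push c (upd s1 a l) bk.
    rewrite updE (negPf ba) => cs; case: c {h1 h2} cs cp => cs cp /=; exact: computes_seq cp cs.
  split; first by rewrite !updE (negPf ab) eqxx.
  split; first by rewrite !updE eqxx -h2.
  by move=> i ia ib; rewrite !updE (negPf ia) (negPf ib) h3.
- by [].
- by exists s' => //; apply: computes_le c; lia.
Qed.

Definition dup_reg c a b : frag k :=
  let put x := seq_frag (push_reg k a x) (push_reg k b x) in
  while_reg c (ite_frag (@true_reg k c) (seq_frag (pop_reg k c) (put true))
                                        (seq_frag (pop_reg k c) (put false))).

Lemma computes_dup c a b s :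
  a < k.+2 -> b < k.+2 -> c < k.+2 -> uniq [:: a; b; c] ->
  exists2 s', computes (dup_reg c a b) s s' (12 * size (s c) + 1) &
    [/\ s' a = catrev (s c) (s a), s' b = catrev (s c) (s b) &
        forall i, i \notin [:: a; b; c] -> s' i = s i].
Proof.
move=> ak bk ck; rewrite /= !inE negb_or => /and3P[/andP[ab ac] bc _].
pose I l (s' : store) := [/\ s' c = l, catrev l (s' a) = catrev (s c) (s a),
  catrev l (s' b) = catrev (s c) (s b) &
  forall i, i \notin [:: a; b; c] -> s' i = s i].
pose put x := seq_frag (push_reg k a x) (push_reg k b x).
have [|||s' cm [h1 h2 h3 h4]] := @computes_for c
    (ite_frag (@true_reg k c) (seq_frag (pop_reg k c) (put true))
                (seq_frag (pop_reg k c) (put false))) 10 I ck _ _ (s c) s.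
- by move=> l s' [].
- move=> x l s1 [h1 h2 h3 h4].
  exists (upd (upd (upd s1 c l) a (x :: s1 a)) b (x :: s1 b)).
    apply: (computes_if_true (n := 1 + 1 + (3 + 1 + 3))) => //.
    have cp := computes_pop s1 ck; rewrite h1 /= in cp.
    rewrite h1; have c1 := computes_push x (upd s1 c l) ak.
    rewrite updE (negPf ac) in c1.
    have c2 := computes_push x (upd (upd s1 c l) a (x :: s1 a)) bk.
    rewrite !updE eq_sym (negPf ab) (negPf bc) in c2.
    by have := computes_seq cp (computes_seq c1 c2); case: (x).
  split.
  + by rewrite !updE ![c == _]eq_sym (negPf bc) (negPf ac) eqxx.
  + by rewrite !updE (negPf ab) eqxx -h2.
  + by rewrite !updE eqxx -h3.
  + move=> i; rewrite !inE !negb_or => /and3P[ia ib ic].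
    by rewrite !updE (negPf ia) (negPf ib) (negPf ic) h4 // !inE !negb_or ia ib.
- by split.
- exists s'; last by split.
  by apply: computes_le cm; lia.
Qed.

(** Transfer between stacks reverses a word, so it passes twice: from [a] to the scratch register
    [c], then back to [a] and to [b] simultaneously. *)
Definition copy_reg a b c : frag k :=
  seq_frag (clear_reg k b) (seq_frag (clear_reg k c)
    (seq_frag (move_reg a c) (dup_reg c a b))).

Lemma computes_copy a b c s :
  a < k.+2 -> b < k.+2 -> c < k.+2 -> uniq [:: a; b; c] ->
  exists2 s', computes (copy_reg a b c) s s' (20 * size (s a) + 20) &
    s' b = s a /\ forall i, i \notin [:: b; c] -> s' i = s i.
Proof.
move=> ak bk ck u; have := u; rewrite /= !inE negb_or => /and3P[/andP[ab ac] bc _].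
have c1 := computes_clear s bk; have c2 := computes_clear (upd s b [::]) ck.
have [s1 c3 [e1 e2 e3]] := computes_move (upd (upd s b [::]) c [::]) ak ck ac.
have [s2 c4 [e4 e5 e6]] := computes_dup s1 ak bk ck u.
rewrite !updE eqxx (negPf ac) (negPf ab) in e1 c3.
have ba : b != a by rewrite eq_sym.
have e1b : s1 b = [::] by rewrite e3 // !updE eqxx (negPf bc).
exists s2.
  apply: computes_le (computes_seq c1 (computes_seq c2 (computes_seq c3 c4))).
  by rewrite e1 catrevE cats0 size_rev; lia.
rewrite e1b e1 !catrevE !cats0 revK in e5; rewrite e2 e1 !catrevE !cats0 revK in e4.
split=> // i.
rewrite !inE negb_or => /andP[ib ic]; case: (i =P a) => [-> //|/eqP ia].
by rewrite e6 ?inE ?negb_or ?ia ?ib // e3 // !updE (negPf ib) (negPf ic).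
Qed.

Definition prepend_reg a b c : frag k :=
  seq_frag (clear_reg k c) (seq_frag (move_reg a c) (move_reg c b)).

Lemma computes_prepend a b c s :
  a < k.+2 -> b < k.+2 -> c < k.+2 -> uniq [:: a; b; c] ->
  exists2 s', computes (prepend_reg a b c) s s' (16 * size (s a) + 5) &
    s' b = s a ++ s b /\ forall i, i \notin [:: a; b; c] -> s' i = s i.
Proof.
move=> ak bk ck; rewrite /= !inE negb_or => /and3P[/andP[ab ac] bc _].
have cb : c != b by rewrite eq_sym.
have ba : b != a by rewrite eq_sym.
have c1 := computes_clear s ck.
have [s1 c2 [e1 e2 e3]] := computes_move (upd s c [::]) ak ck ac.
have [s2 c3 [e4 e5 e6]] := computes_move s1 ck bk cb.
rewrite !updE eqxx (negPf ac) in e1 c2.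
exists s2.
  apply: computes_le (computes_seq c1 (computes_seq c2 c3)).
  by rewrite e1 catrevE cats0 size_rev; lia.
split; first by rewrite e4 e1 e3 // updE (negPf bc) !catrevE cats0 revK.
move=> i; rewrite !inE !negb_or => /and3P[ia ib ic].
by rewrite e6 // e3 // updE (negPf ic).
Qed.

(** Words grow at the front only. Hence the right operand of [App] is evaluated first, and [Loop],
    whose counter yields the longest suffix first, ends up with the shortest in front. *)
Fixpoint compile (e : expr) (rho : seq nat) (t : nat) : frag k :=
  match e with
  | Var i => if i < size rho then copy_reg (nth 0 rho i) t t.+1 else clear_reg k t
  | Empty => clear_reg k t
  | Push b e => seq_frag (compile e rho t) (push_reg k t b)
  | Tail e => seq_frag (compile e rho t) (pop_reg k t)
  | If e0 en et ef =>
      seq_frag (compile e0 rho t)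
        (ite_frag (@nonempty_reg k t)
           (ite_frag (@true_reg k t) (compile et rho t) (compile ef rho t))
           (compile en rho t))
  | Let e1 e2 =>
      seq_frag (compile e1 rho t)
        (seq_frag (compile e2 (rcons rho t) t.+1)
           (seq_frag (clear_reg k t) (prepend_reg t.+1 t t.+2)))
  | App e1 e2 =>
      seq_frag (compile e2 rho t)
        (seq_frag (compile e1 rho t.+1) (prepend_reg t.+1 t t.+2))
  | Drop e1 e2 =>
      seq_frag (compile e2 rho t)
        (seq_frag (compile e1 rho t.+1)
           (while_reg t.+1 (seq_frag (pop_reg k t.+1) (pop_reg k t))))
  | Loop e1 e2 =>
      seq_frag (compile e1 rho t.+1)
        (seq_frag (clear_reg k t)
           (while_reg t.+1
              (seq_frag (pop_reg k t.+1)
                 (seq_frag (compile e2 (rcons rho t.+1) t.+2)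
                    (prepend_reg t.+2 t t.+3)))))
  end.

End Compile.

Fixpoint nregs (e : expr) : nat :=
  match e with
  | Var _ => 2
  | Empty => 1
  | Push _ e => nregs e
  | Tail e => nregs e
  | If e0 en et ef => nregs e0 + nregs en + nregs et + nregs ef
  | Let e1 e2 => nregs e1 + nregs e2 + 4
  | App e1 e2 => nregs e1 + nregs e2 + 4
  | Drop e1 e2 => nregs e1 + nregs e2 + 4
  | Loop e1 e2 => nregs e1 + nregs e2 + 4
  end.

Lemma nregs_gt0 e : 0 < nregs e.
Proof. by elim: e => //= *; lia. Qed.

(* The variables live in the registers listed in [rho], all below the target
   register [t]; registers above [t] are scratch. *)
Definition env_in (rho : seq nat) (env : seq (seq bool)) (t : nat) (s : store) :=
  [/\ size rho = size env, all (fun r => r < t) rho &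
      forall i, i < size env -> s (nth 0 rho i) = nth [::] env i].

Lemma env_in_frame rho env t s s' :
  (forall i, i < t -> s' i = s i) -> env_in rho env t s -> env_in rho env t s'.
Proof.
move=> fr [sz lt h]; split=> // i ii; rewrite fr ?h //.
by move/all_nthP: lt; apply; rewrite sz.
Qed.

Lemma env_in_le rho env t t' s :
  t <= t' -> env_in rho env t s -> env_in rho env t' s.
Proof.
by move=> le [sz lt h]; split=> //; apply: sub_all lt => r /leq_trans; apply.
Qed.

Lemma env_in_rcons rho env t s :
  env_in rho env t s -> env_in (rcons rho t) (rcons env (s t)) t.+1 s.
Proof.
move=> [sz lt h]; split; first by rewrite !size_rcons sz.
  by rewrite all_rcons ltnSn /=; apply: sub_all lt => r /ltnW.
move=> i; rewrite size_rcons ltnS !nth_rcons sz leq_eqVlt.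
by case: ltngtP => //= lt1 _; rewrite h.
Qed.

Section CompileCorrect.
Variable k : nat.

(** The frame condition below [t] keeps variables and pending intermediate values intact while
    subexpressions are evaluated in higher registers. *)
Lemma computes_compile e : forall rho env t s n,
  env_in rho env t s -> all (fun v => size v <= n) env -> t + nregs e <= k.+2 ->
  exists2 s', computes (compile k e rho t) s s' (time_bound e n) &
    s' t = eval e env /\ forall i, i < t -> s' i = s i.
Proof.
have ltne t i j : i < t -> t <= j -> i == j = false by lia.
elim: e => [x||b e IH|e IH|e0 IH0 en IHn et IHt ef IHf|e1 IH1 e2 IH2|e1 IH1 e2 IH2
    |e1 IH1 e2 IH2|e1 IH1 e2 IH2] rho env t s n he hn /= kt.
- have tk : t < k.+2 by lia.
  have [sz lt hx] := he; rewrite sz; case: ltnP => [ltx|gex]; last first.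
    exists (upd s t [::]).
      by apply: computes_le (computes_clear s tk); lia.
    rewrite updE eqxx nth_default //; split=> // i it.
    by rewrite updE (ltne t).
  have rt : nth 0 rho x < t by move/all_nthP: lt; apply; rewrite sz.
  have [||||s' c [e1 e2]] := @computes_copy k (nth 0 rho x) t t.+1 s; try lia.
    by rewrite /= !inE; lia.
  exists s'.
    apply: computes_le c; rewrite hx //; have := all_sizeP x hn; lia.
  split; first by rewrite e1 hx.
  by move=> i it; rewrite e2 // !inE; lia.
- exists (upd s t [::]); first by apply: computes_clear; lia.
  by rewrite updE eqxx; split=> // i it; rewrite updE (ltne t).
- have [s1 c1 [e1 f1]] := IH _ _ _ _ _ he hn kt.
  have tk : t < k.+2 by have := nregs_gt0 e; lia.
  exists (upd s1 t (b :: s1 t)).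
    by apply: computes_le (computes_seq c1 (computes_push b s1 tk)); lia.
  by rewrite updE eqxx e1; split=> // i it; rewrite updE (ltne t) // f1.
- have [s1 c1 [e1 f1]] := IH _ _ _ _ _ he hn kt.
  have tk : t < k.+2 by have := nregs_gt0 e; lia.
  exists (upd s1 t (behead (s1 t))).
    by apply: computes_le (computes_seq c1 (computes_pop s1 tk)); lia.
  by rewrite updE eqxx e1; split=> // i it; rewrite updE (ltne t) // f1.
- have tk : t < k.+2 by have := nregs_gt0 e0; lia.
  have [|s1 c1 [e1 f1]] := IH0 _ _ _ _ _ he hn; first lia.
  have he1 := env_in_frame f1 he.
  have [|sn cn [En fn]] := IHn _ _ _ _ _ he1 hn; first lia.
  have [|st ct [Et ft]] := IHt _ _ _ _ _ he1 hn; first lia.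
  have [|sf cf [Ef ff]] := IHf _ _ _ _ _ he1 hn; first lia.
  case E : (eval e0 env) => [|[] v].
  + exists sn; last by split=> // i it; rewrite fn ?f1.
    apply: computes_le (computes_seq c1 (computes_if_nonempty (n := time_bound en n) tk
        _)); first lia.
    by rewrite e1 E.
  + exists st; last by split=> // i it; rewrite ft ?f1.
    apply: computes_le (computes_seq c1 (computes_if_nonempty tk (n := 1 +
        time_bound et n) _)); first lia.
    by rewrite e1 E /=; apply: computes_if_true; rewrite // e1 E.
  + exists sf; last by split=> // i it; rewrite ff ?f1.
    apply: computes_le (computes_seq c1 (computes_if_nonempty tk (n := 1 +
        time_bound ef n) _)); first lia.
    by rewrite e1 E /=; apply: computes_if_true; rewrite // e1 E.
- have [|s1 c1 [E1 f1]] := IH1 _ _ _ _ _ he hn; first lia.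
  have he1 := env_in_rcons (env_in_frame f1 he); rewrite E1 in he1.
  have hn1 := all_size_rcons hn (size_eval e1 hn).
  have [|s2 c2 [E2 f2]] := IH2 _ _ _ _ _ he1 hn1; first lia.
  have tk : t < k.+2 by lia.
  have c3 := computes_clear s2 tk.
  have [||||s4 c4 [E4 f4]] := @computes_prepend k t.+1 t t.+2 (upd s2 t [::]); try lia.
    by rewrite /= !inE; lia.
  exists s4.
    apply: computes_le (computes_seq c1 (computes_seq c2 (computes_seq c3 c4))).
    rewrite updE (_ : t.+1 == t = false); last lia.
    by rewrite E2; have := size_eval e2 hn1; lia.
  split.
    by rewrite E4 !updE eqxx (_ : t.+1 == t = false) ?cats0 //; lia.
  move=> i it; rewrite f4 ?updE; last by rewrite !inE; lia.
  by rewrite (ltne t) // f2 ?f1 //; lia.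
- have [|s1 c1 [E1 f1]] := IH2 _ _ _ _ _ he hn; first lia.
  have he1 := env_in_le (leqnSn t) (env_in_frame f1 he).
  have [|s2 c2 [E2 f2]] := IH1 _ _ _ _ _ he1 hn; first lia.
  have [||||s4 c4 [E4 f4]] := @computes_prepend k t.+1 t t.+2 s2; try lia.
    by rewrite /= !inE; lia.
  exists s4.
    apply: computes_le (computes_seq c1 (computes_seq c2 c4)).
    by rewrite E2; have := size_eval e1 hn; lia.
  split; first by rewrite E4 E2 f2 // E1.
  move=> i it; rewrite f4; last by rewrite !inE; lia.
  by rewrite f2 ?f1 //; lia.
- have [|s1 c1 [E1 f1]] := IH2 _ _ _ _ _ he hn; first lia.
  have he1 := env_in_le (leqnSn t) (env_in_frame f1 he).
  have [|s2 c2 [E2 f2]] := IH1 _ _ _ _ _ he1 hn; first lia.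
  have tk : t < k.+2 by lia.
  have tk1 : t.+1 < k.+2 by lia.
  pose I l (s' : store) := [/\ s' t.+1 = l,
    drop (size l) (s' t) = drop (size (eval e1 env)) (eval e2 env) &
    forall i, i < t -> s' i = s i].
  have [|||s' c [h1 h2 h3]] := @computes_for k t.+1
      (seq_frag (pop_reg k t.+1) (pop_reg k t)) 3 I tk1 _ _ (eval e1 env) s2.
  + by move=> l s' [].
  + move=> b l s' [h1 h2 h3].
    have c3 := computes_pop s' tk1; have c4 := computes_pop (upd s' t.+1 l) tk.
    rewrite h1 /= in c3; rewrite updE (_ : t == t.+1 = false) in c4; last lia.
    exists (upd (upd s' t.+1 l) t (behead (s' t))); first exact: computes_seq c3 c4.
    split.
    * by rewrite !updE eqxx ifN //; lia.
    * by rewrite !updE eqxx -h2 -drop1 drop_drop addn1.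
    * by move=> i it; rewrite !updE !(ltne t) //; apply: h3.
  + by split=> // [|i it]; [rewrite f2 // E1 | rewrite f2 ?f1 //; lia].
  + exists s'.
      apply: computes_le (computes_seq c1 (computes_seq c2 c)).
      by have := size_eval e1 hn; lia.
    by rewrite drop0 in h2.
- have [|s1 c1 [E1 f1]] := IH1 _ _ _ _ _ (env_in_le (leqnSn t) he) hn; first lia.
  have tk : t < k.+2 by lia.
  have tk1 : t.+1 < k.+2 by lia.
  have c2 := computes_clear s1 tk.
  set L := eval e1 env in E1 *.
  have hL : size L <= size_bound e1 n by exact: size_eval.
  pose m := n + size_bound e1 n.
  (* With [l] left in the counter, the suffixes of length at least [size l] have been treated. *)
  pose I l (s' : store) := [/\ s' t.+1 = l, l = suffix_of L (size l) /\ size l <= size L,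
    s' t = flatten [seq eval e2 (rcons env (suffix_of L i))
        | i <- iota (size l) (size L - size l)] &
    forall i, i < t -> s' i = s i].
  have [|||s' c [h1 h2 h3 h4]] := @computes_for k t.+1
     (seq_frag (pop_reg k t.+1)
                 (seq_frag (compile k e2 (rcons rho t.+1) t.+2)
                    (prepend_reg k t.+2 t t.+3)))
     (1 + 1 + (time_bound e2 m + 1 + (16 * size_bound e2 m + 5))) I tk1 _ _ L (upd s1 t [::]).
  + by move=> l s' [].
  + move=> b l s' [h1 [h2 h2'] h3 h4].
    have c3 := computes_pop s' tk1; rewrite h1 /= in c3.
    have hl : l = suffix_of L (size l).
      rewrite -[LHS]/(behead (b :: l)) {1}h2 /suffix_of -drop1 drop_drop /=.
      by congr drop; move: h2' => /=; lia.
    have he2 : env_in (rcons rho t.+1) (rcons env l) t.+2 (upd s' t.+1 l).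
      have := @env_in_rcons rho env t.+1 (upd s' t.+1 l); rewrite !updE eqxx; apply.
      apply: env_in_le (leqnSn t) _; apply: env_in_frame he => i it.
      by rewrite updE (ltne t) // h4.
    have hn2 : all (fun v => size v <= m) (rcons env l).
      by apply: all_size_rcons hn _; move: h2' hL => /=; lia.
    have [|s4 c4 [E4 f4]] := IH2 _ _ _ _ _ he2 hn2; first lia.
    have [||||s5 c5 [E5 f5]] := @computes_prepend k t.+2 t t.+3 s4; try lia.
      by rewrite /= !inE; lia.
    exists s5.
      apply: computes_le (computes_seq c3 (computes_seq c4 c5)).
      by rewrite E4; have := size_eval e2 hn2; lia.
    split.
    * by rewrite f5 ?inE ?f4 ?updE ?eqxx //; lia.
    * by split=> //; apply: ltnW.
    * have -> : size L - size l = (size L - size (b :: l)).+1 by move: h2' => /=; lia.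
      by rewrite /= E5 E4 f4 // updE ifN ?h3 -?hl //; lia.
    * move=> i it; rewrite f5; last by rewrite !inE; lia.
      by rewrite f4 ?updE ?(ltne t) ?h4 //; lia.
  + split.
    * by rewrite updE ifN ?E1 //; lia.
    * by rewrite /suffix_of subnn drop0.
    * by rewrite updE eqxx subnn.
    * by move=> i it; rewrite updE (ltne t) // f1 //; lia.
  + exists s'; last by rewrite h3 subn0.
    apply: computes_le (computes_seq c1 (computes_seq c2 c)).
    have : size L * (1 + 1 + (time_bound e2 m + 1 + (16 * size_bound e2 m + 5)) + 2)
      <= size_bound e1 n * (time_bound e2 m + 20 * size_bound e2 m + 20).
      by apply: leq_mul => //; lia.
    by rewrite -/m; lia.
Qed.

End CompileCorrect.

(** * From programs to polynomial-time machines *)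

Lemma runs_computes_within k (F : frag k) x y t n :
  runs F (init (machine_of F) x y).2 t n ->
  computes_within (machine_of F) x y (word_at (t ord0).2) n.
Proof.
move=> [q hq [m le_mn e]]; rewrite /computes_within.
have -> : iter n (@step (machine_of F)) (init (machine_of F) x y) = (q, t).
  have e' : iter m (@step (machine_of F)) (init (machine_of F) x y) = (q, t) by [].
  by rewrite -(subnK le_mn) iterD e'; apply: fstep_halt.
by split=> //; rewrite /output word_at_output.
Qed.

Lemma holds_init k (F : frag k) x y :
  holds (init (machine_of F) x y).2 (fun i => nth [::] [:: x; y] i).
Proof. by move=> i ik; rewrite ffunE /= word_at_map inordK. Qed.

Section Embed.
Variables (M : machine) (k : nat) (le_k : (extra_tapes M).+2 <= k.+2).

(** A given machine has its own number of tapes; the surplus ones idle, so that it can be followed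
    by a compiled expression. *)
Definition embed_frag : frag k :=
  @Frag k (state M) (start M) (@halting M) (fun q r =>
    let qa := trans q [ffun i => r (widen_ord le_k i)] in
    (qa.1, fun i => if insub (val i) is Some j then qa.2 j else idle r i)).

Definition restrict_tapes (t : tapes k) : {ffun 'I_(extra_tapes M).+2 -> tape} :=
  [ffun i => t (widen_ord le_k i)].

Lemma step_embed q t :
  step (q, restrict_tapes t) =
  ((@fstep _ embed_frag (q, t)).1, restrict_tapes (@fstep _ embed_frag (q, t)).2).
Proof.
rewrite fstepE /step /=; case: ifP => // _.
have -> : [ffun i => read (restrict_tapes t i)] =
          [ffun i => scan t (widen_ord le_k i)].
  by apply/ffunP => i; rewrite !ffunE.
case: (trans q _) => q' a /=; congr pair.
by apply/ffunP => i; rewrite !ffunE valK.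
Qed.

Lemma iter_step_embed n q t :
  iter n (@step M) (q, restrict_tapes t) =
  ((iter n (@fstep _ embed_frag) (q, t)).1,
   restrict_tapes (iter n (@fstep _ embed_frag) (q, t)).2).
Proof.
elim: n => //= n ->; rewrite step_embed.
by rewrite -surjective_pairing.
Qed.

Lemma runs_embed (F : frag k) x y z n :
  computes_within M x y z n ->
  exists2 t', runs embed_frag (init (machine_of F) x y).2 t' n & word_at (t' ord0).2 = z.
Proof.
rewrite /computes_within.
have -> : init M x y = (start M, restrict_tapes (init (machine_of F) x y).2).
  by congr pair; apply/ffunP => i; rewrite !ffunE.
rewrite iter_step_embed /=; set c := iter _ _ _ => -[hc oc].
exists c.2; first by exists c.1 => //; exists n => //; rewrite -surjective_pairing.
move: oc; rewrite /output word_at_output /= ffunE => <-.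
by congr (word_at (c.2 _).2); apply: val_inj.
Qed.

End Embed.

Lemma size_step_tape (M : machine) (c : config M) i n :
  size (c.2 i).2 <= n -> size ((step c).2 i).2 <= n + 2.
Proof.
move=> h; rewrite /step; case: ifP => _; first by rewrite (leq_trans h) ?leq_addr.
case: (trans _ _) => q a /=; rewrite ffunE.
by move: h; case: (c.2 i) => l r; case: (a i) => u [] /=; rewrite ?size_behead; lia.
Qed.

(** Per step, the write and the move each lengthen the right half by at most one cell. This bounds
    the word that a first machine hands to an expression. *)
Lemma size_computes_within M x y z n :
  computes_within M x y z n -> size z <= size x + 2 * n.
Proof.
move=> [_ <-]; rewrite /output word_at_output.
apply: leq_trans (size_word_at _) _.
elim: n => [|n IH] /=; first by rewrite ffunE /= size_map addn0.
by have := size_step_tape IH; lia.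
Qed.

(* The compiled expression leaves its value in register [t]; the output
   convention wants it on tape [0]. *)
Definition compile_output k (e : expr) (rho : seq nat) (t : nat) : frag k :=
  seq_frag (compile k e rho t) (seq_frag (clear_reg k 0) (prepend_reg k t 0 t.+1)).

Lemma computes_output k e rho env t s n :
  0 < t -> env_in rho env t s -> all (fun v => size v <= n) env ->
  t + nregs e < k.+2 ->
  exists2 s', computes (compile_output k e rho t) s s'
                (time_bound e n + 16 * size_bound e n + 10) &
    s' 0 = eval e env.
Proof.
move=> t0 he hn kt; have ne := nregs_gt0 e.
have [s1 c1 [e1 f1]] := computes_compile he hn (ltnW kt).
have [||||s2 c2 [e2 f2]] := @computes_prepend k t 0 t.+1 (upd s1 0 [::]); try lia.
  by rewrite /= !inE; lia.
have ct : t == 0 = false by lia.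
exists s2; last by rewrite e2 !updE eqxx cats0 ct e1.
apply: computes_le (computes_seq c1 (computes_seq (computes_clear _ _) c2)) => //.
by rewrite updE ct e1; have := size_eval e hn; lia.
Qed.

Theorem polytime_verifier_eval e :
  (forall x c, size (eval e [:: x; c]) = 1) ->
  polytime_verifier (fun x c => head false (eval e [:: x; c])).
Proof.
move=> he; pose k := nregs e + 3.
have [p hp] : poly_bounded (fun n => time_bound e n + 16 * size_bound e n + 10).
  have := poly_bounded_time e; have := poly_bounded_size e => ? ?; poly_bound.
exists (machine_of (compile_output k e [:: 0; 1] 2)), p => x c.
pose s : store := fun i => nth [::] [:: x; c] i.
have [||||s' cs e'] := @computes_output k e [:: 0; 1] [:: x; c] 2 s (size x + size c) => //.
- by split=> // -[|[|i]].
- by rewrite /= !andbT leq_addr leq_addl.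
- by rewrite /k; lia.
have [t' ht rt] := computes_le (hp _) cs (@holds_init k (compile_output k e [:: 0; 1] 2) x c).
have -> : [:: head false (eval e [:: x; c])] = word_at (t' ord0).2.
  have := ht 0 isT; rewrite e' (_ : inord 0 = ord0); last by apply: val_inj; rewrite /= inordK.
  by have := he x c; case: (eval e _) => [|b []] // _ ->.
exact: runs_computes_within.
Qed.

(** The first machine leaves unknown words on tapes other than 0; a compiled expression relies only
    on the registers of its variables. *)
Theorem polytime_eval_comp f e :
  polytime f -> polytime (fun x => eval e [:: f x]).
Proof.
move=> [M [q hq]]; pose k := extra_tapes M + nregs e + 3.
have le_k : (extra_tapes M).+2 <= k.+2 by rewrite /k; lia.
have [p hp] : poly_bounded (fun n => q.[n]%R + 1 +
    (time_bound e (n + 2 * q.[n]%R) + 16 * size_bound e (n + 2 * q.[n]%R) + 10)).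
  have pt := poly_bounded_time e; have ps := poly_bounded_size e.
  have pq : poly_bounded (fun n => q.[n]%R) by exists q.
  by repeat first [ apply: poly_boundedD | apply: poly_boundedM | apply: poly_bounded_const
    | exact: pq | apply: (@poly_bounded_comp (time_bound e)) => //
    | apply: (@poly_bounded_comp (size_bound e)) => // | apply: poly_bounded_id ].
pose F := seq_frag (embed_frag le_k) (compile_output k e [:: 0] 1).
exists (machine_of F), p => x.
have [t1 r1 w1] := @runs_embed M k le_k F x [::] (f x) q.[size x]%R (hq x).
pose s1 : store := fun i => word_at (t1 (inord i)).2.
have h1 : holds (perform (idle (scan t1)) t1) s1 by apply: holds_idle.
have i0 : inord 0 = ord0 :> 'I_k.+2 by apply: val_inj; rewrite /= inordK.
have [||||s' cs e'] := @computes_output k e [:: 0] [:: f x] 1 s1 (size x +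
    2 * q.[size x]%R) => //.
- by split=> // -[|i] // _; rewrite /s1 /= i0.
- by rewrite /= andbT (size_computes_within (hq x)).
- by rewrite /k; lia.
have [t' ht rt] := cs _ h1.
have -> : eval e [:: f x] = word_at (t' ord0).2 by rewrite -e' -(ht 0 isT) i0.
by apply: runs_computes_within; apply: runs_le (hp _) _; apply: runs_seq r1 rt.
Qed.

(** * Vanishing of eta and involutions *)

Section Negation.
Import Order.TTheory GRing.Theory Num.Theory.
Local Open Scope ring_scope.

Variables (N : nat) (N_gt0 : (0 < N)%N).

Definition neg_ord (x : 'I_N) : 'I_N := Ordinal (ltn_pmod (N - x) N_gt0).

Lemma val_neg_ord x : neg_ord x = (if x == 0 :> nat then 0 else N - x)%N :> nat.
Proof.
rewrite /=; case: eqP => [->|/eqP x0]; first by rewrite subn0 modnn.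
by rewrite modn_small //; have := ltn_ord x; lia.
Qed.

Lemma neg_ordK : involutive neg_ord.
Proof.
move=> x; apply: ord_inj; have := ltn_ord x; rewrite val_neg_ord val_neg_ord.
by do 2 case: ifP; lia.
Qed.

Definition neg_perm : {perm 'I_N} := perm (inv_inj neg_ordK).

Lemma neg_permE x : neg_perm x = neg_ord x. Proof. by rewrite permE. Qed.

Lemma neg_permV : (neg_perm^-1)%g = neg_perm.
Proof.
apply/permP => x; rewrite neg_permE; apply: (@perm_inj _ neg_perm).
by rewrite permKV neg_permE neg_ordK.
Qed.

(** As r + s < 2N, the quotient is 0 or 1, and 0 only for r = s = 0, the special case of
    negation. *)
Lemma dvdn_add_ord (r s : 'I_N) : (N %| r + s)%N = (s == neg_ord r).
Proof.
have hr := ltn_ord r; have hs := ltn_ord s.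
apply/idP/eqP => [/dvdnP[q e]|->].
  apply: ord_inj; rewrite val_neg_ord; move: e.
  by case: q => [|[|q]]; case: ifP; nia.
by rewrite val_neg_ord; case: eqP => [->|_] //; rewrite subnKC ?dvdnn // ltnW.
Qed.

End Negation.

(** * The discrete Fourier matrix *)

Section Fourier.
Import Order.TTheory GRing.Theory Num.Theory.
Local Open Scope ring_scope.

Variable R : realType.
Implicit Types (a : R) (N m : nat).

Definition expi a : R[i] := Complex (cos a) (sin a).

Lemma expiX a m : expi a ^+ m = expi (m%:R * a).
Proof.
elim: m => [|m IH]; first by rewrite expr0 mul0r /expi cos0 sin0.
rewrite exprS IH /expi -natr1 mulrDl mul1r addrC cosD sinD.
by apply/eqP; rewrite eq_complex /=; apply/andP; split; apply/eqP; ring.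
Qed.

Lemma expi_mul_conj a : expi a * (expi a)^*%C = 1.
Proof.
apply/eqP; rewrite eq_complex /=; apply/andP; split; apply/eqP; last by ring.
by rewrite mulrN opprK -!expr2 cos2Dsin2.
Qed.

Variables (N : nat) (N_gt0 : (0 < N)%N).

Definition root1 : R[i] := expi (- (2 * pi / N%:R)).

Let N_neq0 : N%:R != 0 :> R. Proof. by rewrite pnatr_eq0 -lt0n. Qed.

Lemma root1_order : root1 ^+ N = 1.
Proof.
rewrite expiX mulrN mulrCA divff // mulr1 /expi cosN sinN.
have -> : 2 * pi = 0 + pi *+ 2 :> R by rewrite add0r mulr_natl.
by rewrite cosD2pi sinD2pi cos0 sin0 oppr0.
Qed.

Lemma root1X_mod m : root1 ^+ (m %% N) = root1 ^+ m.
Proof. by rewrite {2}(divn_eq m N) exprD mulnC exprM root1_order expr1n mul1r. Qed.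

(** For 0 < j < N put a = j pi / N. Equality would give cos(2a) = 1 for the real part, hence sin(a)
    = 0, although a lies strictly between 0 and pi. *)
Lemma root1X_neq1 m : ~~ (N %| m)%N -> root1 ^+ m != 1.
Proof.
move=> Nm; rewrite -root1X_mod; set j := (m %% N)%N.
have j0 : (0 < j)%N by rewrite lt0n.
have jN : (j < N)%N by rewrite ltn_pmod.
apply/eqP; rewrite expiX /expi => -[+ _].
have -> : j%:R * - (2 * pi / N%:R) = - ((j%:R * pi / N%:R) *+ 2) :> R.
  by rewrite -mulr_natl; field.
rewrite cosN cos_mulr2n cos2sin2 => e.
have /lt0r_neq0/negP[] : 0 < sin (j%:R * pi / N%:R : R).
  apply: sin_gt0_pi; rewrite divr_gt0 ?mulr_gt0 ?pi_gt0 ?ltr0n //=.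
  by rewrite ltr_pdivrMr ?ltr0n // mulrC ltr_pM2l ?pi_gt0 // ltr_nat.
rewrite -sqrf_eq0; apply/eqP; move: e; set u := sin _ ^+ 2 => e.
have : u *+ 2 = 0 by rewrite -[RHS](subrr 1) -{2}e mulr2n; ring.
by move/eqP; rewrite mulrn_eq0 /= => /eqP.
Qed.

Lemma sum_root1 m : \sum_(x < N) root1 ^+ (m * x) = if (N %| m)%N then N%:R else 0.
Proof.
under eq_bigr => x _ do rewrite exprM.
case: ifP => [/dvdnP[q ->]|/negbT/root1X_neq1 ne].
  rewrite mulnC exprM root1_order expr1n.
  by under eq_bigr do rewrite expr1n; rewrite sumr_const card_ord.
have := subrX1 (root1 ^+ m) N; rewrite -exprM mulnC exprM root1_order expr1n subrr.
by move/esym/eqP; rewrite mulf_eq0 subr_eq0 (negPf ne) => /eqP.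
Qed.

Let F := fourier R N.
Let c : R[i] := Complex (Num.sqrt N%:R)^-1 0.

Lemma fourierE r x : F r x = c * root1 ^+ (r * x).
Proof.
rewrite mxE expiX /c /expi; apply/eqP; rewrite eq_complex /= !mul0r subr0 addr0.
have -> : (r * x)%:R * - (2 * pi / N%:R) = - (2 * pi * (r%:R * x%:R) / N%:R) :> R.
  by rewrite natrM; ring.
by rewrite !eqxx.
Qed.

Let sqr_c : c ^+ 2 * N%:R = 1.
Proof.
have e : (N%:R : R[i]) = Complex N%:R 0.
  by elim: (N) => [|n IH] //; rewrite -natr1 IH -[RHS](_ : Complex n%:R 0 + 1 = _) //;
     apply/eqP; rewrite eq_complex /= natr1 addr0 !eqxx.
rewrite e expr2; apply/eqP; rewrite eq_complex /= !mul0r !mulr0 !addr0 !subr0.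
by rewrite mul0r addr0 eqxx andbT -expr2 exprVn sqr_sqrtr ?ler0n // mulVf.
Qed.

Lemma fourier_sqr : F *m F = perm_mx (neg_perm N_gt0).
Proof.
apply/matrixP => r s; rewrite !mxE -/F.
under eq_bigr => x _ do
  rewrite !fourierE mulrACA -expr2 -exprD (mulnC x) -mulnDl.
rewrite -mulr_sumr sum_root1 dvdn_add_ord neg_permE eq_sym.
by case: ifP => _; rewrite ?mulr0 // sqr_c.
Qed.

Lemma fourier_unit : F \in unitmx.
Proof.
have : F *m F \in unitmx by rewrite fourier_sqr unitmx_perm.
by rewrite unitmx_mul => /andP[].
Qed.

Lemma conj_root1X m : (root1 ^+ m)^*%C = root1 ^- m.
Proof.
have u : root1 * root1^*%C = 1 by exact: expi_mul_conj.
have -> : (root1 ^+ m)^*%C = root1^*%C ^+ m by rewrite rmorphXn.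
have nz : root1 != 0 by apply/eqP => z; move: u; rewrite z mul0r => /eqP;
    rewrite eq_sym oner_eq0.
by rewrite -exprVn; congr (_ ^+ _); apply: (mulfI nz); rewrite u divff.
Qed.

Lemma conj_fourier r x : (F r x)^*%C = F r (neg_ord N_gt0 x).
Proof.
rewrite !fourierE rmorphM /= conj_root1X; congr (_ * _).
  by rewrite /c /= oppr0.
have nz : root1 ^+ (r * x) != 0.
  by rewrite expf_eq0; apply/negP => /andP[_ /eqP z];
     have /eqP := root1_order; rewrite z expr0n eqn0Ngt N_gt0 eq_sym oner_eq0.
apply: (mulfI nz); rewrite divff // -exprD -mulnDr.
have /dvdnP[q ->] : (N %| x + neg_ord N_gt0 x)%N by rewrite dvdn_add_ord.
by rewrite mulnA [(_ * N)%N]mulnC exprM root1_order expr1n.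
Qed.

End Fourier.

(** * Vanishing of eta as a symmetry of the labeling *)

Section EtaZero.
Import Order.TTheory GRing.Theory Num.Theory.
Local Open Scope ring_scope.

Variable R : realType.

Lemma Im_eq0 (z : R[i]) : (complex.Im z = 0) <-> z^*%C = z.
Proof.
case: z => a b; split=> [/= ->|[] /eqP]; first by rewrite oppr0.
by rewrite eq_sym -addr_eq0 -mulr2n mulrn_eq0 /= => /eqP.
Qed.

Lemma fourier_conj_real N (N_gt0 : (0 < N)%N) (B : 'M[R[i]]_N) :
  (forall x y, (B x y)^*%C = B x y) ->
  (forall r s, complex.Im ((fourier R N *m B *m fourier R N) r s) = 0) <->
  forall x y, B x y = B (neg_ord N_gt0 x) (neg_ord N_gt0 y).
Proof.
move=> realB; set F := fourier R N; set nu := neg_perm N_gt0.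
have FT r x : F r x = F x r by rewrite !fourierE // mulnC.
pose B' := row_perm nu (col_perm nu B).
have conjM : map_mx (@conjc R) (F *m B *m F) = F *m B' *m F.
  rewrite !map_mxM /=.
  have -> : map_mx (@conjc R) B = B by apply/matrixP => x y; rewrite mxE realB.
  have -> : map_mx (@conjc R) F = col_perm nu F.
    by apply/matrixP => r x; rewrite [LHS]mxE [RHS]mxE (conj_fourier R N_gt0) neg_permE.
  (* Conjugation permutes the columns of both factors [F]. The left permutation passes to the rows
     of [B]; the right one becomes a row permutation by symmetry of [F] and passes to the columns of
     [B]. *)
  rewrite mul_col_perm -mulmxA (_ : col_perm nu F = row_perm nu F); last first.
    apply/matrixP => r x; rewrite [LHS]mxE [RHS]mxE !neg_permE.
    by rewrite [RHS]FT -!(conj_fourier R N_gt0) FT.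
  rewrite mul_row_perm !neg_permV mulmxA; congr (_ *m _ *m _).
  by apply/matrixP => x y; rewrite !mxE.
have B'E x y : B' x y = B (neg_ord N_gt0 x) (neg_ord N_gt0 y).
  by rewrite mxE mxE !neg_permE.
split=> [im0 x y|eqB r s].
  rewrite -B'E; have : F *m B *m F = F *m B' *m F.
    by rewrite -conjM; apply/matrixP => r s; rewrite [RHS]mxE; apply/esym/Im_eq0/im0.
  have uF := fourier_unit R N_gt0.
  by move=> /(can_inj (mulmxK uF)) /(can_inj (mulKmx uF)) ->.
apply/Im_eq0; have eB : B' = B by apply/matrixP => x y; rewrite B'E -eqB.
by have := congr1 (fun A : 'M_N => A r s) conjM; rewrite eB mxE.
Qed.

Lemma frobenius_sqr_eq0 m n (A : 'M[R]_(m, n)) :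
  frobenius A ^+ 2 = 0 <-> forall i j, A i j = 0.
Proof.
have ge0 i : 0 <= \sum_j `|A i j| ^+ 2 by apply: sumr_ge0 => j _; rewrite exprn_ge0.
rewrite /frobenius sqr_sqrtr; last by apply: sumr_ge0.
split=> [/psumr_eq0P h i j|h].
  have /psumr_eq0P h' := h (fun i _ => ge0 i) i isT.
  have := h' (fun j _ => exprn_ge0 2 (normr_ge0 _)) j isT.
  by move/eqP; rewrite sqrf_eq0 normr_eq0 => /eqP.
by rewrite big1 // => i _; rewrite big1 // => j _; rewrite h normr0 expr0n.
Qed.

Lemma eta_at_eq0 (G : sgraph) (p : {perm 'I_(gorder G)}) :
  let neg := neg_ord (gorder_gt0 G) in
  eta_at R p = 0 <-> forall x y, adj (p x) (p y) = adj (p (neg x)) (p (neg y)).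
Proof.
move=> neg; rewrite /eta_at frobenius_sqr_eq0.
pose B : 'M[R[i]]_(gorder G) := labeled_adjacency R p.
have realB x y : (B x y)^*%C = B x y by rewrite mxE conjc_nat.
have [im0 negB] := fourier_conj_real (gorder_gt0 G) realB.
split=> [h x y|h i j].
  have : B x y = B (neg x) (neg y) by apply: im0 => r s; have := h r s; rewrite mxE.
  by rewrite !mxE => /eqP; rewrite eqr_nat; do 2 case: adj.
by rewrite mxE; apply: negB => x y; rewrite !mxE h.
Qed.

Lemma eta_eq0 (G : sgraph) :
  eta R G = 0 <-> exists p : {perm 'I_(gorder G)}, eta_at R p = 0.
Proof.
have ge0 (p : {perm 'I_(gorder G)}) : 0 <= eta_at R p by rewrite exprn_even_ge0.
rewrite /eta; split=> [|[p p0]].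
  (* The minimum is attained: being a value of [eta_at] is preserved by [Num.min]. *)
  pose P x := exists p : {perm 'I_(gorder G)}, eta_at R p = x.
  suff : P (\big[Num.min/@eta_at R G 1%g]_p @eta_at R G p).
    by move=> [p ep] h; exists p; rewrite ep.
  elim/big_ind: _ => [|x y Px Py|p _]; [by exists 1%g | | by exists p].
  by rewrite /Num.min; case: ifP.
apply/eqP; rewrite eq_le; apply/andP; split; last by apply: le_bigmin.
by rewrite -p0; apply: bigmin_le.
Qed.

End EtaZero.

(** * Involutions conjugate to negation *)

Definition automorphism (G : sgraph) (t : {perm 'I_(gorder G)}) : Prop :=
  forall u v, adj (t u) (t v) = adj u v.

(* The case [i = j] is allowed. *)
Definition fixes_only (T : finType) (t : {perm T}) (i j : T) : Prop :=
  [/\ t i = i, t j = j & forall v, t v = v -> v = i \/ v = j].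

(** Whether there is one fixed point or two is forced by the parity of the order, so one definition
    covers both cases. *)
Definition has_near_fpf_involution (G : sgraph) : Prop :=
  exists t : {perm 'I_(gorder G)},
    [/\ automorphism t, forall v, t (t v) = v & exists i j, fixes_only t i j].

(* An involution of ['I_N] with one or two fixed points is conjugate to negation:
   list [i], then one element of each 2-cycle, then [j] (if [j != i]), then the
   partners in reverse order. *)
Lemma negation_conjugate N (N_gt0 : 0 < N) (t : {perm 'I_N}) i j :
  (forall v, t (t v) = v) -> fixes_only t i j ->
  exists p : {perm 'I_N}, forall x, p (neg_ord N_gt0 x) = t (p x).
Proof.
move=> tK [ti tj fixed].
pose S := [seq v : 'I_N <- enum 'I_N | v < t v].
pose J := if i == j then [::] else [:: j].
pose L' := S ++ J ++ rev (map t S); pose L := i :: L'.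
have memS (v : 'I_N) : (v \in S) = (v < t v) by rewrite mem_filter mem_enum andbT.
have memT (v : 'I_N) : (v \in map t S) = (t v < v).
  apply/mapP/idP => [[w + ->]|h]; first by rewrite memS tK.
  by exists (t v); rewrite ?memS tK.
have memJ v : (v \in J) = (v != i) && (v == j).
  rewrite /J; case: (i =P j) => [->|/eqP ne]; rewrite /= ?in_nil ?mem_seq1.
    by rewrite andNb.
  by case: (v =P j) => [->|]; rewrite ?andbF // andbT eq_sym ne.
have memL v : v \in L.
  rewrite inE !mem_cat mem_rev memS memT memJ.
  case: ltngtP => [||/ord_inj e]; rewrite ?orbT //.
  by case: (fixed v (esym e)) => ->; rewrite eqxx //=; case: (j == i).
have uniqL : uniq L.
  rewrite /= !mem_cat mem_rev memS memT memJ ti ltnn eqxx /= !cat_uniq.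
  rewrite rev_uniq map_inj_uniq; last exact: perm_inj.
  rewrite filter_uniq ?enum_uniq //= andbT.
  apply/and3P; split.
  - apply/hasPn => v; rewrite mem_cat mem_rev memT memJ memS.
    by case/orP => [/andP[_ /eqP ->]|h]; rewrite ?tj ?ltnn // -leqNgt ltnW.
  - by rewrite /J; case: ifP.
  - apply/hasPn => v; rewrite mem_rev memT memJ.
    by case: (v =P j) => [->|]; rewrite ?andbF // tj ltnn.
have sizeL : size L = N.
  by rewrite -[RHS](card_ord N) -(card_uniqP uniqL); apply: eq_card => v; rewrite memL.
(* Reversing the list amounts to applying [t]; this is what turns negation of positions into [t]. *)
have revL' : rev L' = map t L'.
  rewrite /L' !rev_cat revK !map_cat map_rev -map_comp -catA.
  congr (_ ++ _ ++ rev _); last by rewrite -[LHS]map_id; apply: eq_map => v /=; rewrite tK.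
  by rewrite /J; case: ifP => //= _; rewrite tj.
pose f (x : 'I_N) := nth i L x.
have f_inj : injective f.
  by move=> x y /eqP; rewrite nth_uniq ?sizeL // => /eqP /val_inj.
exists (perm f_inj) => x; rewrite !permE /f val_neg_ord.
have sizeL' : size L' = N.-1 by exact: (congr1 predn sizeL).
have := ltn_ord x; case: (nat_of_ord x) => [|k] kN /=; first by rewrite ti.
(* Past the head [i], position k + 1 of [L] is position k of [L'], and its negative is the mirror
   position in [L']. *)
have -> : N - k.+1 = (size L' - k.+1).+1 by rewrite sizeL'; lia.
have kL : k < size L' by rewrite sizeL'; lia.
by rewrite /= -nth_rev // revL' (nth_map i).
Qed.

Lemma near_fpf_labeling (G : sgraph) :
  let neg := neg_ord (gorder_gt0 G) in
  (exists p : {perm 'I_(gorder G)},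
     forall x y, adj (p x) (p y) = adj (p (neg x)) (p (neg y))) <->
  has_near_fpf_involution G.
Proof.
move=> neg; set N := gorder G; split=> [[p hp]|[t [ta tK [i [j tij]]]]]; last first.
  have [p hp] := negation_conjugate (gorder_gt0 G) tK tij.
  by exists p => x y; rewrite !hp ta.
pose t : {perm 'I_N} := (p^-1 * neg_perm (gorder_gt0 G) * p)%g.
have tE v : t v = p (neg (p^-1%g v)) by rewrite !permM neg_permE.
exists t; split=> [u v|v|]; first by rewrite !tE -hp !permKV.
  by rewrite !tE permK /neg neg_ordK permKV.
(* Negation fixes 0 and, for even N, also N/2; for odd N the point 0 is listed twice. *)
have half_lt : (if odd N then 0 else N./2) < N.
  by have := gorder_gt0 G; rewrite -/N; case: ifP; lia.
have tp w : t (p w) = p w <-> neg w = w.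
  by rewrite tE permK; split=> [/perm_inj|->].
exists (p (Ordinal (gorder_gt0 G))), (p (Ordinal half_lt)).
split=> [||v tv].
- by apply/tp/ord_inj; rewrite val_neg_ord.
- by apply/tp/ord_inj; rewrite val_neg_ord /=; do 2 case: ifP; lia.
- have [w ev] : exists w, v = p w by exists (p^-1%g v); rewrite permKV.
  move: tv; rewrite ev => /tp /(congr1 val); rewrite [LHS]val_neg_ord /= => e.
  have [w0|w0] := eqVneq (w : nat) 0; first by left; congr (p _); apply: ord_inj.
  right; congr (p _); apply: ord_inj => /=; rewrite (negPf w0) in e.
  by have := ltn_ord w; rewrite -/N in e *; case: ifP; lia.
Qed.

Theorem eta_eq0_involution (R : realType) (G : sgraph) :
  eta R G = 0%R <-> has_near_fpf_involution G.
Proof.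
rewrite eta_eq0 -near_fpf_labeling.
by split=> -[p h]; exists p; have [to from] := eta_at_eq0 R p; [exact: to | exact: from].
Qed.

(** The moved points split into those with v < t v and those with t v < v, and [t] exchanges the two
    sets. *)
Lemma odd_fixed_points N (t : {perm 'I_N}) :
  (forall v, t (t v) = v) -> odd #|[set v | t v == v]| = odd N.
Proof.
move=> tK; pose S := [set v : 'I_N | v < t v].
have eT : [set v : 'I_N | t v < v] = [set t v | v in S].
  apply/setP => v; rewrite inE; apply/idP/imsetP => [h|[w + ->]].
    by exists (t v); rewrite ?inE tK.
  by rewrite inE tK.
have cT : #|[set v : 'I_N | t v < v]| = #|S|.
  by rewrite eT card_imset //; exact: perm_inj.
rewrite -[in RHS](card_ord N) -cardsT -(cardsID [set v | t v == v] setT) oddD setTI.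
rewrite setTD (_ : ~: _ = S :|: [set v : 'I_N | t v < v]); last first.
  by apply/setP => v; rewrite !inE -val_eqE neq_ltn orbC.
rewrite cardsU (_ : S :&: _ = set0) ?cards0 ?subn0 ?cT ?addnn ?odd_double ?addbF //.
by apply/setP => v; rewrite !inE; apply/negP => /andP[/ltn_trans h /h]; rewrite ltnn.
Qed.

(** * The graph reduction *)

(** Adjacency on plain numbers lets graphs of different orders, and graphs and words, be compared
    without casts between ordinals. *)
Definition nadj (G : sgraph) (i j : nat) : bool :=
  match insub i, insub j with
  | Some u, Some v => @adj G u v
  | _, _ => false
  end.

Lemma nadj_ord G (u v : 'I_(gorder G)) : nadj G u v = adj u v.
Proof. by rewrite /nadj !valK. Qed.

Lemma nadj_sym G : symmetric (nadj G).
Proof.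
by move=> i j; rewrite /nadj; case: insubP => [u _ _|_]; case: insubP => [v _ _|_] //;
   rewrite adj_sym.
Qed.

Lemma nadj_irr G : irreflexive (nadj G).
Proof. by move=> i; rewrite /nadj; case: insubP => // u _ _; rewrite adj_irr. Qed.

Lemma nadj_ge G i j : gorder G <= i -> nadj G i j = false.
Proof. by move=> h; rewrite /nadj insubF // ltnNge h. Qed.

Lemma encodeE G :
  encode G = nseq (gorder G) true ++
    false :: [seq nadj G i j | i <- iota 0 (gorder G), j <- iota 0 (gorder G)].
Proof.
rewrite /encode -val_enum_ord; congr (_ ++ _ :: _).
rewrite allpairs_mapl allpairs_mapr.
by congr flatten; apply: eq_map => u; apply: eq_map => v; rewrite nadj_ord.
Qed.

Lemma universal_connected G (u : 'I_(gorder G)) : universal u -> connected_graph G.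
Proof.
move=> uu; have uP v : connect (@adj G) u v.
  by have [->|ne] := eqVneq v u; [exact: connect0 | apply: connect1; apply: uu].
move=> v w; apply: connect_trans (uP w).
by rewrite (sym_connect_sym (@adj_sym G)).
Qed.

Section Gadget.
Variable H : sgraph.
Local Notation n := (gorder H).

(* [H] with two isolated vertices [n], [n+1] and a universal vertex [n+2] added;
   the isolated vertices make the universal one unique. *)
Definition gadget_rel (i j : nat) : bool := ((i == n.+2) (+) (j == n.+2)) || nadj H i j.

Lemma gadget_rel_sym : symmetric gadget_rel.
Proof. by move=> i j; rewrite /gadget_rel addbC nadj_sym. Qed.

Lemma gadget_rel_irr : irreflexive gadget_rel.
Proof. by move=> i; rewrite /gadget_rel addbb nadj_irr. Qed.

Definition gadget : sgraph :=
  @SGraph n.+3 (fun u v => gadget_rel u v) isT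
    (fun u v => gadget_rel_sym u v) (fun u => gadget_rel_irr u).

Definition hub : 'I_(gorder gadget) := Ordinal (ltnSn n.+2).

Lemma gadget_rel_small i j : i != n.+2 -> j != n.+2 -> gadget_rel i j = nadj H i j.
Proof. by move=> /negPf hi /negPf hj; rewrite /gadget_rel hi hj. Qed.

Lemma universal_gadget (v : 'I_(gorder gadget)) : universal v <-> v = hub.
Proof.
split=> [uv|->]; last first.
  by move=> u /negPf ne; rewrite /adj /= /gadget_rel eqxx -[u == _ :> nat]/(u == hub) ne.
apply/eqP; apply: contraT => /negPf ne.
have neq : v != n.+2 :> nat by rewrite -[_ == _]/(v == hub) ne.
(* An added isolated vertex other than [v]: no vertex but the hub is adjacent to it. *)
pose w := if v == n :> nat then n.+1 else n.
have wN : w < n.+3 by rewrite /w; case: ifP; lia.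
have vw : Ordinal wN != v.
  by rewrite -val_eqE; change (w != v); rewrite /w; case: ifP; lia.
have := uv _ vw; rewrite /adj /= gadget_rel_small //.
  by rewrite nadj_sym nadj_ge // /w; case: ifP; lia.
by rewrite /w; case: ifP; lia.
Qed.

Lemma gadget_unique_universal : unique_universal gadget.
Proof.
exists hub; split; first by apply/universal_gadget.
by move=> v /universal_gadget.
Qed.

Lemma gadget_connected : connected_graph gadget.
Proof. by apply: (@universal_connected gadget hub); apply/universal_gadget. Qed.

Lemma gadget_near_fpf : has_fpf_involution H -> has_near_fpf_involution gadget.
Proof.
move=> [t [ta tK tN]].
(* The extension of [t] swaps the two isolated vertices and fixes the hub alone. *)
pose g i := if insub i is Some v then val (t v)
            else if i == n then n.+1 else if i == n.+1 then n else i.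
have g_ord (v : 'I_n) : g v = t v by rewrite /g valK.
have g_ge i : n <= i -> g i = if i == n then n.+1 else if i == n.+1 then n else i.
  by move=> h; rewrite /g insubF // ltnNge h.
have g_ge_n i : n <= i -> n <= g i by move=> h; rewrite g_ge //; do ?case: ifP; lia.
have split_ord (i : nat) : (exists v : 'I_n, i = v) \/ n <= i.
  by have [h|h] := ltnP i n; [left; exists (Ordinal h) | right].
have gK i : g (g i) = i.
  have [[v ->]|h] := split_ord i; first by rewrite g_ord g_ord tK.
  by rewrite g_ge ?g_ge_n // g_ge //; do ?case: ifP; lia.
have g_adj i j : nadj H (g i) (g j) = nadj H i j.
  have [[u ->]|h] := split_ord i; last by rewrite !nadj_ge ?g_ge_n.
  have [[v ->]|h] := split_ord j; last by rewrite nadj_sym nadj_ge ?g_ge_n // nadj_sym nadj_ge.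
  by rewrite !g_ord !nadj_ord ta.
have g_hub i : (g i == n.+2) = (i == n.+2).
  have [[v ->]|h] := split_ord i; last by rewrite g_ge //; do ?case: ifP; lia.
  by rewrite g_ord; have := ltn_ord v; have := ltn_ord (t v); lia.
have g_lt (v : 'I_n.+3) : g v < n.+3.
  have [[w ->]|h] := split_ord v; first by rewrite g_ord; have := ltn_ord (t w); lia.
  by rewrite g_ge //; have := ltn_ord v; do ?case: ifP; lia.
pose f v : 'I_n.+3 := Ordinal (g_lt v).
have fK : involutive f by move=> v; apply: val_inj; apply: gK.
exists (perm (inv_inj fK)); split=> [u v|v|].
- by rewrite !permE /adj /= /gadget_rel !g_hub g_adj.
- by rewrite !permE fK.
exists hub, hub; split; rewrite ?permE.
- by apply: val_inj => /=; rewrite g_ge //; do ?case: ifP; lia.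
- by apply: val_inj => /=; rewrite g_ge //; do ?case: ifP; lia.
move=> -[k kN]; have kN3 : k < n.+3 := kN; rewrite permE => /(congr1 val) /= e; left;
    apply: val_inj => /=.
have [[w ew]|h] := split_ord k.
  by move: e; rewrite ew g_ord => /val_inj e; have := tN w; rewrite e eqxx.
by move: e; rewrite g_ge //; do ?case: ifP; lia.
Qed.

Lemma automorphism_hub (t : {perm 'I_(gorder gadget)}) :
  automorphism t -> t hub = hub.
Proof.
move=> ta; apply/universal_gadget => v ne; rewrite -(permKV t v) ta.
have /universal_gadget := erefl hub; apply.
by apply: contraNneq ne => <-; rewrite permKV.
Qed.

(* If [t v] is one of the added isolated vertices, say [n], then [v] is isolated
   in [H] and can be paired with the isolated vertex [t (n+1)] instead. *)
Lemma near_fpf_gadget :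
  ~~ odd n -> has_near_fpf_involution gadget -> has_fpf_involution H.
Proof.
move=> n_even [t [ta tK [i [j [ti tj fixed]]]]].
have thub := automorphism_hub ta.
have fix_hub v : t v = v -> v = hub.
  (* The order of the gadget is odd, hence so is the number of fixed points, which excludes two
     distinct ones. *)
  have eij : i = j.
    apply/eqP; apply: contraT => ne; have := odd_fixed_points tK.
    have -> : [set v | t v == v] = [set i; j].
      apply/setP => w; rewrite !inE; apply/eqP/orP => [/fixed[]->|[]/eqP->] //;
        by rewrite eqxx; auto.
    by rewrite cards2 ne /= (negPf n_even).
  by move=> /fixed; case: (fixed _ thub) => ->; rewrite eij => -[].
pose T k := val (t (inord k)) : nat.
have vT k : k < n.+3 -> t (inord k) = inord (T k) by rewrite /T inord_val.
have T_lt k : T k < n.+3 by apply: ltn_ord.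
have TK k : k < n.+3 -> T (T k) = k.
  by move=> kn; rewrite {1}/T -vT // tK /= inordK.
have T_hub : T n.+2 = n.+2.
  by rewrite /T (_ : inord _ = hub) ?thub //; apply: val_inj; rewrite /= inordK.
have T_fix k : k < n.+2 -> T k <> k.
  move=> kn e; have /fix_hub/(congr1 val) : t (inord k) = inord k by rewrite vT ?e //; lia.
  by rewrite /= inordK; lia.
have T_small k : k < n.+2 -> T k < n.+2.
  move=> kn; have := T_lt k; suff : T k <> n.+2 by lia.
  by move=> e; have := TK k; rewrite e T_hub; lia.
have T_adj k l : k < n.+2 -> l < n.+2 -> nadj H (T k) (T l) = nadj H k l.
  move=> kn ln; have kn' := T_small _ kn; have ln' := T_small _ ln.
  rewrite -!gadget_rel_small; try lia.
  have := ta (inord k) (inord l); rewrite /adj /= -/(T k) -/(T l) !inordK //; lia.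
pose sw k := if k == n then n.+1 else n.
pose g k := if T k < n then T k else T (sw (T k)).
have g_ge k : k < n -> n <= T k ->
   [/\ g k = T (sw (T k)), n <= sw (T k) < n.+2, sw (T k) <> T k & sw (sw (T k)) = T k].
  move=> kn h; rewrite /g ltnNge h /=; have kn2 : k < n.+2 by lia.
  by have := T_small _ kn2; rewrite /sw; split=> //; do ?case: ifP; lia.
have g_lt k : k < n -> g k < n.
  move=> kn; case: (ltnP (T k) n) => h; first by rewrite /g h.
  have [-> /andP[s1 s2] s3 s4] := g_ge _ kn h.
  have kn3 : k < n.+3 by lia.
  have sn3 : sw (T k) < n.+3 by lia.
  have := T_small _ s2; have := T_fix _ s2; have := TK _ sn3; have := TK _ kn3.
  have kn2 : k < n.+2 by lia.
  have := T_small _ kn2.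
  case: (ltnP (T (sw (T k))) n) => // h' a1 a2 a3 a4 a5.
  (* If both values were added vertices, then [T (sw (T k))], which differs from [sw (T k)], would
     be the other one, [T k]. Applying [T] gives [sw (T k) = k], absurd since k < n. *)
  have e : T (sw (T k)) = T k by lia.
  by move: a3; rewrite e; lia.
have gK k : k < n -> g (g k) = k.
  move=> kn; have kn3 : k < n.+3 by lia.
  case: (ltnP (T k) n) => h.
    by rewrite /g h TK // kn.
  have lt := g_lt _ kn; have [e /andP[s1 s2] s3 s4] := g_ge _ kn h.
  have sn3 : sw (T k) < n.+3 by lia.
  have eT : T (g k) = sw (T k) by rewrite e TK.
  have [|-> _ _ _] := g_ge _ lt; first by rewrite eT.
  by rewrite eT s4 TK.
have gN k : k < n -> g k <> k.
  move=> kn; have kn3 : k < n.+3 by lia.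
  case: (ltnP (T k) n) => h.
    by rewrite /g h; apply: T_fix; lia.
  have [-> /andP[s1 s2] s3 s4] := g_ge _ kn h => e.
  have sn3 : sw (T k) < n.+3 by lia.
  by have := TK _ sn3; rewrite e; lia.
(* Away from the hub [T] preserves adjacency, so both [k] and its new partner, being images of added
   isolated vertices, are isolated in [H]. *)
have iso k l : k < n -> l < n -> n <= T k -> nadj H k l = false /\ nadj H (g k) (g l) = false.
  move=> kn ln h; have kn2 : k < n.+2 by lia.
  have ln2 : l < n.+2 by lia.
  split; first by rewrite -T_adj // nadj_ge.
  have [-> /andP[s1 s2] _ _] := g_ge _ kn h.
  have gl := g_lt _ ln; have gl2 : g l < n.+2 by lia.
  have gl3 : g l < n.+3 by lia.
  by rewrite -(TK _ gl3) T_adj ?T_small // nadj_ge.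
have g_adj k l : k < n -> l < n -> nadj H (g k) (g l) = nadj H k l.
  move=> kn ln; case: (ltnP (T k) n) => hk; last by have [-> ->] := iso _ _ kn ln hk.
  case: (ltnP (T l) n) => hl; last first.
    by have [e1 e2] := iso _ _ ln kn hl; rewrite nadj_sym e2 nadj_sym e1.
  by rewrite /g hk hl T_adj //; lia.
pose f (v : 'I_n) := Ordinal (g_lt _ (ltn_ord v)).
have fK : involutive f by move=> v; apply: val_inj; apply: gK.
exists (perm (inv_inj fK)); split=> [u v|v|v]; rewrite !permE ?fK //.
- by rewrite -!nadj_ord g_adj.
- by apply/eqP => /(congr1 val) /= e; apply: (gN _ (ltn_ord v)).
Qed.

End Gadget.

Lemma has_fpf_involution_even (G : sgraph) : has_fpf_involution G -> ~~ odd (gorder G).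
Proof.
move=> [t [_ tK tN]]; rewrite -(odd_fixed_points tK).
suff -> : [set v | t v == v] = set0 by rewrite cards0.
by apply/setP => v; rewrite !inE (negPf (tN v)).
Qed.

Theorem eta_gadget (R : realType) (H : sgraph) :
  ~~ odd (gorder H) -> eta R (gadget H) = 0%R <-> has_fpf_involution H.
Proof.
move=> n_even; rewrite eta_eq0_involution; split; first exact: near_fpf_gadget.
exact: gadget_near_fpf.
Qed.

(** K_{1,3} is a negative instance of even order, so its gadget has odd order. If an automorphism
    moves the centre to a leaf, every leaf must go to the centre, the only neighbour of that leaf;
    two leaves contradict injectivity. *)
Definition star_rel (i j : 'I_4) : bool := (i == ord0) (+) (j == ord0).

Lemma star_sym : symmetric star_rel. Proof. by move=> i j; rewrite /star_rel addbC. Qed.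
Lemma star_irr : irreflexive star_rel. Proof. by move=> i; rewrite /star_rel addbb. Qed.

Definition star : sgraph := @SGraph 4 star_rel isT star_sym star_irr.

Lemma star_no_fpf_involution : ~ has_fpf_involution star.
Proof.
move=> [t [ta _ tN]]; have /negPf t0 := tN ord0.
have leaf (i : 'I_4) : i != ord0 -> t i = ord0.
  move=> /negPf ni; have := ta ord0 i; rewrite /adj /= /star_rel t0 eqxx ni /=.
  by move/eqP.
by have /perm_inj/(congr1 val) := etrans (leaf (lift ord0 ord0) isT)
                                     (esym (leaf (lift ord0 (lift ord0 ord0)) isT)).
Qed.

(** * Formulas on encoded graphs *)

(* An expression is read as a formula, true when its value is not empty. *)
Definition sat (e : expr) (env : seq (seq bool)) : bool := eval e env != [::].

Definition fTrue := Push true Empty.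
Definition fNot a := If a fTrue Empty Empty.
Definition fAnd a b := If a Empty b b.
Definition fOr a b := App a b.
Definition fImp a b := If a fTrue b b.
Definition fIff a b := If a (fNot b) b b.
Definition fXor a b := fNot (fIff a b).
Definition fAll e b := fNot (Loop e (fNot b)).
Definition fLt a b := Drop a b.
Definition fEq a b := fAnd (fNot (Drop a b)) (fNot (Drop b a)).
Definition fBit e i := If (Drop i e) Empty fTrue Empty.
Definition word_of_bool a := If a (Push false Empty) fTrue fTrue.
Definition const (s : seq bool) := foldr Push Empty s.

Lemma eval_const s env : eval (const s) env = s.
Proof. by elim: s => //= b s ->. Qed.

Lemma sat_If e a b env : sat (If e a b b) env = if sat e env then sat b env else sat a env.
Proof. by rewrite /sat /=; case: (eval e env) => [|[]]. Qed.

Lemma sat_Not a env : sat (fNot a) env = ~~ sat a env.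
Proof. by rewrite sat_If; case: sat. Qed.

Lemma sat_And a b env : sat (fAnd a b) env = sat a env && sat b env.
Proof. by rewrite sat_If; case: sat. Qed.

Lemma sat_Or a b env : sat (fOr a b) env = sat a env || sat b env.
Proof. by rewrite /sat /=; case: (eval a env). Qed.

Lemma sat_Imp a b env : sat (fImp a b) env = (sat a env ==> sat b env).
Proof. by rewrite sat_If; case: (sat a env). Qed.

Lemma sat_Iff a b env : sat (fIff a b) env = (sat a env == sat b env).
Proof. by rewrite sat_If sat_Not; case: (sat a env); case: (sat b env). Qed.

Lemma sat_Xor a b env : sat (fXor a b) env = sat a env (+) sat b env.
Proof. by rewrite sat_Not sat_Iff; case: (sat a env); case: (sat b env). Qed.

Lemma sat_Lt a b env : sat (fLt a b) env = (size (eval a env) < size (eval b env)).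
Proof. by rewrite /sat /= -size_eq0 size_drop subn_eq0 -ltnNge. Qed.

Lemma sat_Eq a b env : sat (fEq a b) env = (size (eval a env) == size (eval b env)).
Proof. by rewrite sat_And !sat_Not !sat_Lt -!leqNgt eqn_leq andbC. Qed.

Lemma sat_Bit e i env : sat (fBit e i) env = nth false (eval e env) (size (eval i env)).
Proof.
rewrite /sat /= -[size _]addn0 -nth_drop addn0; set s := drop _ _.
by case: s => [|[] s].
Qed.

(** A concatenation is nonempty iff one of its parts is, so [Loop] is a bounded existential
    quantifier. *)
Lemma sat_Loop e b env m :
  size (eval e env) = m ->
  sat (Loop e b) env = [exists i : 'I_m, sat b (rcons env (suffix_of (eval e env) i))].
Proof.
move=> <-; rewrite /sat /=; set f := fun i => eval b _.
have -> : (flatten (map f (iota 0 (size (eval e env)))) != [::]) =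
          has (fun i => f i != [::]) (iota 0 (size (eval e env))).
  by elim: (iota _ _) => //= i s <-; case: (f i).
apply/hasP/existsP => [[v + h]|[v h]].
  by rewrite mem_iota => /= lt; exists (Ordinal lt).
by exists (val v) => //; rewrite mem_iota /=.
Qed.

Lemma sat_All e b env m :
  size (eval e env) = m ->
  sat (fAll e b) env = [forall i : 'I_m, sat b (rcons env (suffix_of (eval e env) i))].
Proof.
move=> em; rewrite sat_Not (sat_Loop _ em) negb_exists.
by apply: eq_forallb => i; rewrite sat_Not negbK.
Qed.

Lemma eval_word_of_bool a env : eval (word_of_bool a) env = [:: sat a env].
Proof. by rewrite /sat /=; case: (eval a env) => [|[]]. Qed.

Lemma size_Loop_const e b env v :
  (forall s, eval b (rcons env s) = v) ->
  size (eval (Loop e b) env) = size (eval e env) * size v.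
Proof.
move=> h /=; set l := eval e env; rewrite -[size l in RHS](size_iota 0).
by elim: (iota _ _) => //= i s IH; rewrite size_cat h IH.
Qed.

Lemma nth_allpairs_iota (f : nat -> nat -> bool) n m i j :
  i < n -> j < m ->
  nth false [seq f i j | i <- iota 0 n, j <- iota 0 m] (i * m + j) = f i j.
Proof.
(* Removing a row shifts the start of the outer range, so the induction needs an arbitrary start. *)
move=> + jm; suff shifted a : i < n ->
    nth false [seq f i j | i <- iota a n, j <- iota 0 m] (i * m + j) = f (a + i) j.
  exact: (shifted 0).
elim: n a i => // n IH a [|i] lt /=.
  rewrite mul0n add0n nth_cat size_map size_iota jm (nth_map 0) ?size_iota //.
  by rewrite nth_iota // add0n addn0.
by rewrite nth_cat size_map size_iota mulSn -addnA ltnNge leq_addr /= addKn IH // addSnnS.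
Qed.

(** * Words that encode graphs *)

Definition word_adj (w : seq bool) (n i j : nat) : bool :=
  nth false w (n.+1 + (i * n + j)).

Lemma size_encode G : size (encode G) = (gorder G).+1 + gorder G * gorder G.
Proof.
by rewrite encodeE size_cat size_nseq /= size_allpairs !size_iota addnS addSn.
Qed.

Lemma word_adj_encode G i j :
  i < gorder G -> j < gorder G -> word_adj (encode G) (gorder G) i j = nadj G i j.
Proof.
move=> hi hj; rewrite /word_adj encodeE nth_cat size_nseq.
rewrite ifN; last by lia.
rewrite (_ : _ - _ = (i * gorder G + j).+1); last by lia.
by rewrite /= nth_allpairs_iota.
Qed.

Definition valid_word (w : seq bool) (n : nat) : bool :=
  [&& 0 < n, size w == n.+1 + n * n, [forall i : 'I_n, nth false w i],
      ~~ nth false w n &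
      [forall i : 'I_n, ~~ word_adj w n i i &&
        [forall j : 'I_n, word_adj w n i j == word_adj w n j i]]].

Lemma valid_encode G : valid_word (encode G) (gorder G).
Proof.
apply/and5P; split; first exact: gorder_gt0; first by rewrite size_encode.
- by apply/forallP => i; rewrite encodeE nth_cat size_nseq ltn_ord nth_nseq ltn_ord.
- by rewrite encodeE nth_cat size_nseq ltnn subnn.
- apply/forallP => i; rewrite word_adj_encode // nadj_irr /=; apply/forallP => j.
  by rewrite !word_adj_encode // nadj_sym.
Qed.

Lemma valid_wordP w n :
  valid_word w n -> exists2 G, gorder G = n & encode G = w.
Proof.
case/and5P => n0 /eqP sz /forallP ones sep /forallP mat.
have irr (i : 'I_n) : word_adj w n i i = false by have /andP[/negPf] := mat i.
have sym (i j : 'I_n) : word_adj w n i j = word_adj w n j i.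
  by have /andP[_ /forallP/(_ j)/eqP] := mat i.
exists (@SGraph n (fun i j => word_adj w n i j) n0 sym irr) => //.
set G := SGraph _ _ _; apply: (@eq_from_nth _ false); first by rewrite size_encode sz.
move=> k; rewrite size_encode /= => kn.
have [lt|gt|->] := ltngtP k n.
- rewrite encodeE nth_cat size_nseq lt nth_nseq lt.
  by have := ones (Ordinal lt) => /= ->.
- have n_pos : n > 0 by [].
  pose q := (k - n.+1) %/ n; pose r := (k - n.+1) %% n.
  have ek : k = n.+1 + (q * n + r) by rewrite -divn_eq subnKC.
  have rn : r < n by rewrite ltn_mod.
  have qn : q < n by rewrite ltn_divLR //; lia.
  rewrite {1}ek; have := @word_adj_encode G q r qn rn; rewrite /word_adj => ->.
  by rewrite -[q]/(val (Ordinal qn)) -[r]/(val (Ordinal rn)) (@nadj_ord G) [in RHS]ek.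
- rewrite encodeE nth_cat size_nseq ltnn subnn /=.
  by apply/esym/negbTE.
Qed.

(** The length n + 1 + n^2 is strictly increasing in n, so it determines the order. *)
Lemma encode_size_inj G n : (size (encode G) == n.+1 + n * n) = (n == gorder G).
Proof. by rewrite size_encode; apply/eqP/eqP => [|->] //; nia. Qed.

(** Languages quantify over the graph behind a word, so separate statements about one word must be
    shown to concern the same graph. A graph carries a relation and proofs, whence extensionality
    and proof irrelevance. *)
Lemma encode_inj : injective encode.
Proof.
move=> G G' e; have := encode_size_inj G (gorder G').
rewrite e size_encode eqxx => /esym/eqP.
have adjE (u v : nat) : nadj G u v = nadj G' u v.
  have eqG : gorder G' = gorder G.
    by have := encode_size_inj G (gorder G'); rewrite e size_encode eqxx => /esym/eqP.
  case: (ltnP u (gorder G)) => hu; last by rewrite !nadj_ge ?eqG.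
  case: (ltnP v (gorder G)) => hv; last first.
    by rewrite nadj_sym nadj_ge // nadj_sym nadj_ge // eqG.
  by rewrite -!word_adj_encode ?eqG // e.
move: adjE {e}; case: G => n a n0 s i; case: G' => n' a' n0' s' i' /= + e.
move: a' n0' s' i'; rewrite e => a' n0' s' i' h.
have ea : a = a'.
  apply/boolp.funext => u; apply/boolp.funext => v; move: (h u v).
  by rewrite (@nadj_ord (SGraph n0 s i)) (@nadj_ord (SGraph n0' s' i')).
by move: s' i' {h}; rewrite -ea => s' i'; congr SGraph; exact: boolp.Prop_irrelevance.
Qed.

(* In the formulas, [w], [n], [c] and [i], [j], ... are the levels of the word, of
   a string of length the order, of the certificate and of vertices; [d] is the
   first free level. *)
Definition adj_expr (w n i j : nat) :=
  fBit (Var w) (App (Push true (Var n)) (App (Loop (Var i) (Var n)) (Var j))).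

Definition order_expr (w n : nat) :=
  fEq (Var w) (App (Push true (Var n)) (Loop (Var n) (Var n))).

Definition valid_expr (w n d : nat) :=
  fAnd (Var n) (fAnd (order_expr w n)
    (fAnd (fAll (Var n) (fBit (Var w) (Var d)))
      (fAnd (fNot (fBit (Var w) (Var n)))
        (fAll (Var n) (fAnd (fNot (adj_expr w n d d))
          (fAll (Var n) (fIff (adj_expr w n d d.+1) (adj_expr w n d.+1 d)))))))).

(** Integers are lengths: one copy of [Var n] per round of the loop multiplies them. *)
Lemma size_mul_expr i n env :
  i < size env -> n < size env ->
  size (eval (Loop (Var i) (Var n)) env) = size (nth [::] env i) * size (nth [::] env n).
Proof.
move=> hi hn; apply: size_Loop_const => s /=.
by rewrite nth_rcons hn.
Qed.

Lemma sat_adj_expr w n i j env :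
  all (fun k => k < size env) [:: w; n; i; j] ->
  sat (adj_expr w n i j) env =
  word_adj (nth [::] env w) (size (nth [::] env n)) (size (nth [::] env i)) (size (nth [::]
      env j)).
Proof.
move=> /and5P[hw hn hi hj _]; rewrite sat_Bit /word_adj; congr nth.
change (size (eval (Push true (Var n)) env ++ (eval (Loop (Var i) (Var n)) env ++ nth [::]
    env j))
  = (size (nth [::] env n)).+1 + (size (nth [::] env i) * size (nth [::] env n) +
      size (nth [::] env j))).
by rewrite !size_cat size_mul_expr.
Qed.

Lemma sat_order_expr w n env :
  w < size env -> n < size env ->
  sat (order_expr w n) env =
  (size (nth [::] env w) == (size (nth [::] env n)).+1 +
      size (nth [::] env n) * size (nth [::] env n)).
Proof.
move=> hw hn; rewrite sat_Eq; congr (_ == _).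
change (size (eval (Push true (Var n)) env ++ eval (Loop (Var n) (Var n)) env) = 
 (size (nth [::] env n)).+1 + size (nth [::] env n) * size (nth [::] env n)).
by rewrite size_cat size_mul_expr.
Qed.

Lemma size_suffix_ord (s : seq bool) n (i : 'I_n) : size s = n -> size (suffix_of s i) = i.
Proof. by move=> sn; rewrite size_suffix_of // sn ltnW. Qed.

Lemma sat_valid_expr w n env N :
  w < size env -> n < size env -> size (nth [::] env n) = N ->
  sat (valid_expr w n (size env)) env = valid_word (nth [::] env w) N.
Proof.
move=> hw hn eN; rewrite /valid_word 4!sat_And; congr [&& _, _, _, _ & _].
- by rewrite /sat -size_eq0 /= eN lt0n.
- by rewrite sat_order_expr // eN.
- rewrite (@sat_All (Var n) _ env N eN); apply: eq_forallb => i.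
  by rewrite sat_Bit /= !nth_rcons hw ltnn eqxx size_suffix_ord.
- by rewrite sat_Not sat_Bit /= eN.
rewrite (@sat_All (Var n) _ env N eN); apply: eq_forallb => i.
rewrite sat_And sat_Not sat_adj_expr ?size_rcons;
    last by rewrite /= !ltnS !leqnn !(ltnW hw) !(ltnW hn).
rewrite !nth_rcons hw hn ltnn eqxx size_suffix_ord //= eN; congr (_ && _).
rewrite (@sat_All _ _ _ N); last by rewrite /= nth_rcons hn.
apply: eq_forallb => j; rewrite sat_Iff !sat_adj_expr ?size_rcons; try by rewrite /=; lia.
rewrite !nth_rcons !size_rcons !ltnS !leqnn (ltnW hw) (ltnW hn) hw hn ltnn eqxx /=.
by rewrite eqxx nth_rcons hn !size_suffix_ord ?eN.
Qed.

(** * Certificates for involutions *)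

Definition cert_expr (c n i j : nat) :=
  fBit (Var c) (App (Loop (Var i) (Var n)) (Var j)).

Definition even_expr (n d : nat) := Loop (Var n) (fEq (App (Var d) (Var d)) (Var n)).

Lemma sat_cert_expr c n i j env :
  all (fun k => k < size env) [:: c; n; i; j] ->
  sat (cert_expr c n i j) env =
  nth false (nth [::] env c) (size (nth [::] env i) * size (nth [::] env n) +
      size (nth [::] env j)).
Proof.
move=> /and5P[hc hn hi hj _]; rewrite sat_Bit; congr nth.
change (size (eval (Loop (Var i) (Var n)) env ++ nth [::] env j)
  = size (nth [::] env i) * size (nth [::] env n) + size (nth [::] env j)).
by rewrite size_cat size_mul_expr.
Qed.

(** The witness N/2 must be the length of a proper suffix, which requires N > 0. *)
Lemma sat_even_expr n env N :
  n < size env -> size (nth [::] env n) = N -> 0 < N ->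
  sat (even_expr n (size env)) env = ~~ odd N.
Proof.
move=> hn eN N0; rewrite (@sat_Loop (Var n) _ env N eN).
apply/existsP/idP => [[v]|ev].
  rewrite sat_Eq /= size_cat !nth_rcons hn ltnn eqxx size_suffix_ord // eN => /eqP <-.
  by rewrite addnn odd_double.
have hN : N./2 < N by lia.
exists (Ordinal hN); rewrite sat_Eq /= size_cat !nth_rcons hn ltnn eqxx eN.
by rewrite (@size_suffix_ord _ _ (Ordinal hN)) //= addnn; lia.
Qed.

(** The certificate is the bit matrix of the graph of the map. A total, functional and symmetric
    relation is the graph of an involution, so bijectivity comes for free. *)
Definition involution_certificate (G : sgraph) (C : rel 'I_(gorder G)) : bool :=
  [&& [forall i, exists j, C i j],
      [forall i, forall j, C i j ==> C j i && [forall k, C i k ==> (j == k)]],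
      [forall i, forall j, forall i', C i i' ==>
         [forall j', C j j' ==> (adj i j == adj i' j')]] &
      [exists i, exists j, [&& C i i, C j j &
         [forall k, C k k ==> (k == i) || (k == j)]]]].

(* Levels: 0 is the instance, 1 the certificate, 2 the order. *)
Definition involution_expr :=
  let A := adj_expr 0 2 in let C := cert_expr 1 2 in let All := fAll (Var 2) in
  fAnd (All (Loop (Var 2) (C 3 4)))
  (fAnd (All (All (fImp (C 3 4) (fAnd (C 4 3) (All (fImp (C 3 5) (fEq (Var 4) (Var 5))))))))
  (fAnd (All (All (All (fImp (C 3 5) (All (fImp (C 4 6) (fIff (A 3 4) (A 5 6))))))))
   (Loop (Var 2) (Loop (Var 2) (fAnd (C 3 3) (fAnd (C 4 4)
      (All (fImp (C 5 5) (fOr (fEq (Var 5) (Var 3)) (fEq (Var 5) (Var 4))))))))))).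

Definition cert_rel (c : seq bool) (n : nat) : rel 'I_n :=
  fun i j => nth false c (i * n + j).

Lemma sat_involution_expr G c N :
  size N = gorder G ->
  sat involution_expr [:: encode G; c; N] = involution_certificate (cert_rel c (n := gorder G)).
Proof.
move=> eN; have sN (i : 'I_(gorder G)) : size (suffix_of N i) = i by exact: size_suffix_ord.
rewrite /involution_expr /= 3!sat_And /involution_certificate; congr [&& _, _, _ & _].
- rewrite (@sat_All _ _ _ (gorder G)) //; apply: eq_forallb => i.
  rewrite (@sat_Loop _ _ _ (gorder G)) //; apply: eq_existsb => j.
  by rewrite sat_cert_expr //= !sN eN.
- rewrite (@sat_All _ _ _ (gorder G)) //; apply: eq_forallb => i.
  rewrite (@sat_All _ _ _ (gorder G)) //; apply: eq_forallb => j.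
  rewrite sat_Imp sat_And !sat_cert_expr //= !sN eN; congr (_ ==> _ && _).
  rewrite (@sat_All _ _ _ (gorder G)) //; apply: eq_forallb => k.
  by rewrite sat_Imp sat_Eq sat_cert_expr //= !sN eN.
- rewrite (@sat_All _ _ _ (gorder G)) //; apply: eq_forallb => i.
  rewrite (@sat_All _ _ _ (gorder G)) //; apply: eq_forallb => j.
  rewrite (@sat_All _ _ _ (gorder G)) //; apply: eq_forallb => i'.
  rewrite sat_Imp sat_cert_expr //= !sN eN; congr (_ ==> _).
  rewrite (@sat_All _ _ _ (gorder G)) //; apply: eq_forallb => j'.
  by rewrite sat_Imp sat_Iff sat_cert_expr // !sat_adj_expr //= !sN eN !word_adj_encode //
      !nadj_ord.
- rewrite (@sat_Loop _ _ _ (gorder G)) //; apply: eq_existsb => i.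
  rewrite (@sat_Loop _ _ _ (gorder G)) //; apply: eq_existsb => j.
  rewrite 2!sat_And !sat_cert_expr //= !sN eN; congr [&& _, _ & _].
  rewrite (@sat_All _ _ _ (gorder G)) //; apply: eq_forallb => k.
  by rewrite sat_Imp sat_Or !sat_Eq sat_cert_expr //= !sN eN.
Qed.

Lemma involution_of_certificate G (C : rel 'I_(gorder G)) :
  involution_certificate C -> has_near_fpf_involution G.
Proof.
case/and4P => /forallP tot /forallP fn /forallP aut /existsP[i /existsP[j fix_ij]].
pose t u := xchoose (existsP (tot u)).
have Ct u : C u (t u) by apply: (xchooseP (existsP (tot u))).
have Csym u v : C u v -> C v u.
  by move=> h; have /forallP/(_ v)/implyP/(_ h)/andP[] := fn u.
have Cfun u v w : C u v -> C u w -> v = w.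
  move=> h1 h2; have /forallP/(_ v)/implyP/(_ h1)/andP[_] := fn u.
  by move=> /forallP/(_ w)/implyP/(_ h2)/eqP.
have tK : involutive t by move=> u; apply: (Cfun (t u)) => //; apply: Csym.
exists (perm (inv_inj tK)); split=> [u v|v|]; rewrite ?permE //.
  have /forallP/(_ v)/forallP/(_ (t u))/implyP/(_ (Ct u)) := aut u.
  by move=> /forallP/(_ (t v))/implyP/(_ (Ct v))/eqP.
case/and3P: fix_ij => Ci Cj /forallP fix_ij.
exists i, j; split=> [||v]; rewrite permE; [exact: Cfun (Ct i) Ci|exact: Cfun (Ct j) Cj|].
move=> tv; have := Ct v; rewrite tv => /(implyP (fix_ij v)).
by case/orP => /eqP; auto.
Qed.

Lemma certificate_of_involution G :
  has_near_fpf_involution G ->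
  exists2 c, size c <= gorder G * gorder G &
    involution_certificate (cert_rel c (n := gorder G)).
Proof.
move=> [t [ta tK [i [j [ti tj tN]]]]].
pose f a b := if insub a is Some u then val (t u) == b else false.
exists [seq f a b | a <- iota 0 (gorder G), b <- iota 0 (gorder G)].
  by rewrite size_allpairs !size_iota.
set C := cert_rel _ (n := _).
have CE u v : C u v = (t u == v).
  by rewrite /C /cert_rel nth_allpairs_iota // /f valK.
apply/and4P; split.
- by apply/forallP => u; apply/existsP; exists (t u); rewrite CE.
- apply/forallP => u; apply/forallP => v; rewrite !CE; apply/implyP => /eqP <-.
  by rewrite tK eqxx; apply/forallP => w; rewrite CE; apply/implyP.
- apply/forallP => u; apply/forallP => v; apply/forallP => u'; rewrite CE.
  apply/implyP => /eqP <-; apply/forallP => v'; rewrite CE; apply/implyP => /eqP <-.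
  by rewrite ta.
apply/existsP; exists i; apply/existsP; exists j; rewrite !CE ti tj !eqxx /=.
apply/forallP => k; rewrite CE; apply/implyP => /eqP /tN[] ->; rewrite eqxx ?orbT //.
Qed.

(** * Membership in NP *)

Definition instance_expr (e : expr) : expr :=
  Loop (Var 0) (fAnd (valid_expr 0 2 3) e).

(** The order is searched for among the lengths of proper suffixes of the word; it occurs there
    because an encoding is longer than its order. *)
Lemma sat_instance_expr e (Q : sgraph -> seq bool -> bool) x c :
  (forall G c N, size N = gorder G -> sat e [:: encode G; c; N] = Q G c) ->
  sat (instance_expr e) [:: x; c] <-> exists G, x = encode G /\ Q G c.
Proof.
move=> he; rewrite (@sat_Loop _ _ _ (size x)) //.
have sN (i : 'I_(size x)) : size (suffix_of x i) = i by exact: size_suffix_ord.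
have validE N m : size N = m -> sat (valid_expr 0 2 3) [:: x; c; N] = valid_word x m.
  by move=> sm; exact: (@sat_valid_expr 0 2 [:: x; c; N] m).
split=> [/existsP[v]|[G [eG QG]]].
  rewrite /= sat_And; have := sN v; move: (suffix_of x v) => N.
  move: (nat_of_ord v) => m sm.
  rewrite (validE _ _ sm).
  by move=> /andP[/valid_wordP[G eG <-]]; rewrite he ?sm // => QG; exists G.
have lt : gorder G < size x by rewrite eG size_encode; lia.
apply/existsP; exists (Ordinal lt); have /= sG := sN (Ordinal lt).
rewrite /= sat_And (validE _ _ sG).
by rewrite eG valid_encode /= he // -eG.
Qed.

Lemma NP_graph_language e (Q : sgraph -> seq bool -> bool) (P : sgraph -> Prop) :
  (forall G c N, size N = gorder G -> sat e [:: encode G; c; N] = Q G c) ->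
  (forall G c, Q G c -> P G) ->
  (forall G, P G -> exists2 c, size c <= gorder G * gorder G & Q G c) ->
  NP (graph_language P).
Proof.
move=> he sound complete; pose v := word_of_bool (instance_expr e).
have ve x c : head false (eval v [:: x; c]) = sat (instance_expr e) [:: x; c].
  by rewrite eval_word_of_bool.
exists (fun x c => head false (eval v [:: x; c])), ('X * 'X)%R; split.
  by apply: polytime_verifier_eval => x c; rewrite eval_word_of_bool.
move=> x; rewrite hornerM hornerX; split=> [[G [-> /complete[c sc Qc]]]|[c [_]]].
  exists c; split; first by apply: leq_trans sc _; apply: leq_mul; rewrite size_encode; lia.
  by rewrite ve; apply/(sat_instance_expr _ _ he); exists G.
by rewrite ve => /(sat_instance_expr _ _ he)[G [-> /sound PG]]; exists G.
Qed.

Theorem NP_eta_eq0 (R : realType) : NP (graph_language (fun G => eta R G = 0%R)).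
Proof.
apply: (NP_graph_language (fun G c N => @sat_involution_expr G c N)) => [G c h|G].
  by apply/eta_eq0_involution; apply: involution_of_certificate h.
by move=> /eta_eq0_involution /certificate_of_involution.
Qed.

Definition universalb G (u : 'I_(gorder G)) : bool := [forall v, (v == u) || adj u v].

Lemma universalP G (u : 'I_(gorder G)) : reflect (universal u) (universalb u).
Proof.
apply: (iffP forallP) => [h v /negPf ne|h v]; first by have := h v; rewrite ne.
by case: eqVneq => //= ne; apply: h.
Qed.

Definition unique_universalb (G : sgraph) : bool :=
  [exists u : 'I_(gorder G), universalb u && [forall v, universalb v ==> (v == u)]].

Lemma unique_universalP G : reflect (unique_universal G) (unique_universalb G).
Proof.
apply: (iffP existsP) => [[u /andP[/universalP uu /forallP h]]|[u [/universalP uu h]]].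
  by exists u; split=> // v /universalP uv; apply/esym/eqP; have := h v; rewrite uv.
exists u; rewrite uu; apply/forallP => v; apply/implyP => /universalP /h ->.
by rewrite eqxx.
Qed.

Definition universal_expr (i j : nat) :=
  fAll (Var 2) (fOr (fEq (Var j) (Var i)) (adj_expr 0 2 i j)).

Definition unique_universal_expr :=
  Loop (Var 2) (fAnd (universal_expr 3 4)
    (fAll (Var 2) (fImp (universal_expr 4 5) (fEq (Var 4) (Var 3))))).

Lemma sat_unique_universal_expr G c N :
  size N = gorder G -> sat unique_universal_expr [:: encode G; c; N] = unique_universalb G.
Proof.
move=> eN; have sN (i : 'I_(gorder G)) : size (suffix_of N i) = i by exact: size_suffix_ord.
rewrite (@sat_Loop _ _ _ (gorder G)) //; apply: eq_existsb => i.
rewrite sat_And; congr (_ && _).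
  rewrite (@sat_All _ _ _ (gorder G)) //; apply: eq_forallb => j.
  by rewrite sat_Or sat_Eq sat_adj_expr //= !sN eN word_adj_encode // nadj_ord.
rewrite (@sat_All _ _ _ (gorder G)) //; apply: eq_forallb => j.
rewrite sat_Imp sat_Eq /= !sN; congr (_ ==> _).
rewrite (@sat_All _ _ _ (gorder G)) //; apply: eq_forallb => k.
by rewrite sat_Or sat_Eq sat_adj_expr //= !sN eN word_adj_encode // nadj_ord.
Qed.

(** A universal vertex makes the graph connected, which spares the verifier a reachability test. *)
Theorem NP_eta_eq0_restricted (R : realType) :
  NP (graph_language (fun G =>
    (connected_graph G /\ odd (gorder G) /\ unique_universal G) /\ eta R G = 0%R)).
Proof.
pose e := fAnd (fNot (even_expr 2 3)) (fAnd unique_universal_expr involution_expr).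
pose Q G c := [&& odd (gorder G), unique_universalb G &
                  involution_certificate (cert_rel c (n := gorder G))].
apply: (@NP_graph_language e Q) => [G c N eN|G c|G].
- rewrite /e sat_And sat_Not (@sat_even_expr 2 [:: encode G; c; N] (gorder G)) //.
    by rewrite negbK sat_And sat_unique_universal_expr // sat_involution_expr.
  exact: gorder_gt0.
- case/and3P => od /unique_universalP uu /involution_of_certificate h.
  split; last by apply/eta_eq0_involution.
  by split=> //; case: uu => u [/universal_connected].
- move=> [[_ [od /unique_universalP uu]] /eta_eq0_involution /certificate_of_involution[c
    sc hc]].
  by exists c => //; apply/and3P.
Qed.

(** * The reduction on words *)

(* Levels: 1 is the instance, 2 its order, 3 the order of the gadget, 4 and 5 the
   row and the column. *)
Definition gadget_entry_expr : expr :=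
  let hub := Push true (Push true (Var 2)) in
  fOr (fXor (fEq (Var 4) hub) (fEq (Var 5) hub))
    (fAnd (fLt (Var 4) (Var 2)) (fAnd (fLt (Var 5) (Var 2)) (adj_expr 1 2 4 5))).

Definition gadget_expr : expr :=
  Let (Push true (Push true (Push true (Var 2))))
    (App (Loop (Var 3) fTrue)
      (Push false (Loop (Var 3) (Loop (Var 3) (word_of_bool gadget_entry_expr))))).

Lemma eval_gadget_expr H w N :
  size N = gorder H -> eval gadget_expr [:: w; encode H; N] = encode (gadget H).
Proof.
move=> eN; rewrite [RHS]encodeE /gadget_expr; set n := gorder H in eN *.
have eM : size [:: true, true, true & N] = n.+3 by rewrite /= eN.
change (eval (Let _ _) _) with
  (eval (Loop (Var 3) fTrue) [:: w; encode H; N; [:: true, true, true & N]] ++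
   false :: eval (Loop (Var 3) (Loop (Var 3) (word_of_bool gadget_entry_expr)))
     [:: w; encode H; N; [:: true, true, true & N]]).
congr (_ ++ _ :: _).
  have ones : forall s, flatten [seq [:: true] | _ <- iota s n.+3] = nseq n.+3 true.
    by elim: n.+3 => //= m IH s; rewrite IH.
  change (flatten [seq [:: true]
      | _ <- iota 0 (size [:: true, true, true & N])] = nseq n.+3 true).
  by rewrite eM ones.
set M := [:: true, true, true & N] in eM *.
change (flatten [seq flatten [seq eval (word_of_bool gadget_entry_expr)
    [:: w; encode H; N; M; suffix_of M i;
        suffix_of M j] | j <- iota 0 (size M)] | i <- iota 0 (size M)]
  = flatten [seq [seq nadj (gadget H) i j | j <- iota 0 n.+3] | i <- iota 0 n.+3]).
rewrite eM; congr flatten; apply/eq_in_map => i; rewrite mem_iota => /andP[_ ni];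
    rewrite add0n in ni.
rewrite -[RHS]flatten_map1; congr flatten; apply/eq_in_map => j;
    rewrite mem_iota => /andP[_ nj]; rewrite add0n in nj.
rewrite eval_word_of_bool; congr [:: _].
have si : size (suffix_of M i) = i by rewrite size_suffix_of // eM ltnW.
have sj : size (suffix_of M j) = j by rewrite size_suffix_of // eM ltnW.
rewrite sat_Or sat_Xor !sat_Eq 2!sat_And !sat_Lt sat_adj_expr //= si sj eN -/n.
rewrite -[i in RHS]/(nat_of_ord (Ordinal ni)) -[j in RHS]/(nat_of_ord (Ordinal nj)).
rewrite (@nadj_ord (gadget H)) /adj /= /gadget_rel; congr (_ || _).
case: (ltnP i n) => hi /=; last by rewrite nadj_ge.
case: (ltnP j n) => hj /=; last by rewrite nadj_sym nadj_ge.
exact: word_adj_encode.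
Qed.

Definition even_instance_expr : expr :=
  Loop (Var 0) (fAnd (valid_expr 0 1 2) (even_expr 1 2)).

Lemma sat_even_instance_expr w :
  sat even_instance_expr [:: w] <-> exists2 G, ~~ odd (gorder G) & encode G = w.
Proof.
rewrite (@sat_Loop _ _ _ (size w)) //.
have sN (i : 'I_(size w)) : size (suffix_of w i) = i by exact: size_suffix_ord.
have validE N m : size N = m -> sat (valid_expr 0 1 2) [:: w; N] = valid_word w m.
  by move=> sm; exact: (@sat_valid_expr 0 1 [:: w; N] m).
have evenE N m : size N = m -> 0 < m -> sat (even_expr 1 2) [:: w; N] = ~~ odd m.
  by move=> sm m0; exact: (@sat_even_expr 1 [:: w; N] m).
split=> [/existsP[v]|[G ev eG]].
  rewrite /= sat_And; have := sN v; move: (suffix_of w v) => N.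
  move: (nat_of_ord v) => m sm; rewrite (validE _ _ sm).
  case/andP => /valid_wordP[G eG ew]; rewrite (evenE _ _ sm) -eG ?gorder_gt0 // => ev.
  by exists G.
have lt : gorder G < size w by rewrite -eG size_encode; lia.
apply/existsP; exists (Ordinal lt); have /= sG := sN (Ordinal lt).
by rewrite /= sat_And (validE _ _ sG) (evenE _ _ sG) ?gorder_gt0 // ev -eG valid_encode.
Qed.

(* Exactly one [n] satisfies [size w = n + 1 + n * n], so the outer loop outputs
   once. Words that are not instances of even order are negative. *)
Definition reduction_expr : expr :=
  Let (If even_instance_expr (const (encode star)) (Var 0) (Var 0))
    (Loop (Var 1) (If (order_expr 1 2) Empty gadget_expr gadget_expr)).

Lemma flatten_single (f : nat -> seq bool) m k :
  k < m -> flatten [seq if i == k then f i else [::] | i <- iota 0 m] = f k.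
Proof.
move=> km; have {1}-> : m = k + (1 + (m - k.+1)) by lia.
rewrite !iotaD !map_cat !flatten_cat /= eqxx !cats0 add0n.
have nil s : k \notin s -> flatten [seq if i == k then f i else [::] | i <- s] = [::].
  by elim: s => //= i s IH; rewrite inE negb_or eq_sym => /andP[/negPf -> /IH].
by rewrite !nil ?cats0 // mem_iota; lia.
Qed.

Lemma eval_If e a b env : eval (If e a b b) env = if sat e env then eval b env else eval a env.
Proof. by rewrite /sat /=; case: (eval e env) => [|[]]. Qed.

(** Every word is traded for a graph of even order with the same answer: its own graph, or the star.
    Graphs of odd order are safely sent to the star, since a fixed-point-free involution pairs off
    the vertices. *)
Lemma eval_reduction_expr w :
  exists H, [/\ eval reduction_expr [:: w] = encode (gadget H), ~~ odd (gorder H) &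
    graph_language has_fpf_involution w <-> has_fpf_involution H].
Proof.
set out := Loop (Var 1) (If (order_expr 1 2) Empty gadget_expr gadget_expr).
have outE H : eval out [:: w; encode H] = encode (gadget H).
  have lt : gorder H < size (encode H) by rewrite size_encode; lia.
  have sH := size_suffix_of (ltnW lt).
  pose f i := eval gadget_expr [:: w; encode H; suffix_of (encode H) i].
  rewrite -(eval_gadget_expr w sH) -[RHS](flatten_single f lt).
  congr flatten; apply/eq_in_map => i; rewrite mem_iota add0n => /andP[_ li].
  have orderE : sat (order_expr 1 2) [:: w; encode H; suffix_of (encode H) i] = (i == gorder H).
    by rewrite sat_order_expr //= size_suffix_of ?encode_size_inj // ltnW.
  by rewrite -[LHS]/(eval (If (order_expr 1 2) Empty gadget_expr gadget_expr)
    [:: w; encode H; suffix_of (encode H) i]) eval_If orderE.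
have redE v : (if sat even_instance_expr [:: w] then w else encode star) = v ->
    eval reduction_expr [:: w] = eval out [:: w; v].
  move=> <-; rewrite -[LHS]/(eval out [:: w; eval (If even_instance_expr
    (const (encode star)) (Var 0) (Var 0)) [:: w]]) eval_If.
  by case: sat; rewrite ?eval_const.
case: (boolP (sat even_instance_expr [:: w])) => [yes|no].
  have /sat_even_instance_expr[H ev ew] := yes; exists H; split=> //.
    by rewrite (redE (encode H)) ?outE // yes.
  by rewrite -ew; split=> [[G [/encode_inj ->]] //|h]; exists H.
exists star; split=> //; first by rewrite (redE (encode star)) ?outE // (negPf no).
split=> [[G [eG h]]|/star_no_fpf_involution //]; case/negP: no.
by apply/sat_even_instance_expr; exists G => //; exact: has_fpf_involution_even h.
Qed.

(** One reduction serves both the general and the restricted problem, as all its values encode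
    admissible graphs. *)
Lemma eta_eq0_hard (R : realType) :
  NP_complete (graph_language has_fpf_involution) ->
  forall L', NP L' -> exists f,
    reduction L' (graph_language (fun G => eta R G = 0%R)) f /\
    forall x, graph_language (fun G =>
      connected_graph G /\ odd (gorder G) /\ unique_universal G) (f x).
Proof.
move=> [_ hard] L' /hard[f [pf hf]]; exists (fun x => eval reduction_expr [:: f x]).
split=> [|x].
  split=> [|x]; first exact: polytime_eval_comp.
  rewrite hf; have [H [-> ev ->]] := eval_reduction_expr (f x).
  rewrite -(eta_gadget R ev); split=> [h|[G [/encode_inj <-]] //].
  by exists (gadget H).
have [H [-> ev _]] := eval_reduction_expr (f x).
exists (gadget H); split=> //; split; first exact: gadget_connected.
by split; [rewrite /= negbK | exact: gadget_unique_universal].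
Qed.

Theorem theorem6p2 (R : realType)
    (lubiw : NP_complete (graph_language has_fpf_involution)) :
  NP_complete (graph_language (fun G => eta R G = 0%R)) /\
  NP_complete_on
    (graph_language (fun G => connected_graph G /\ odd (gorder G) /\ unique_universal G))
    (graph_language (fun G => eta R G = 0%R)).
Proof.
have hard := eta_eq0_hard R lubiw.
split; split; [exact: NP_eta_eq0 | by move=> L' /hard[f [? _]]; exists f | | exact: hard].
have [V [p [pV VP]]] := NP_eta_eq0_restricted R; exists V, p; split=> // x.
rewrite -VP; split=> [[[G [eG DG]] [G' [eG' LG']]]|[G [eG [DG LG]]]]; last first.
  by split; exists G.
(* The two memberships provide graphs with the same encoding; injectivity identifies them. *)
exists G; split=> //; split=> //.
by rewrite (encode_inj (etrans (esym eG) eG')).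
Qed.
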